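(* Let $k\ge 3$ be an integer and let $h\ge 1$ be a positive integer. Then $$\sum_{\substack{\chi \bmod k\\ \chi \text{ odd}}}|L(2h+1,\chi)|^2=-\frac{2^{4h}\pi^{4h+2}}{((2h+1)!)^2k^2}\,\phi(k)\,\Sigma_2,$$ where \begin{align*} \Sigma_2=&\sum_{q_1=0}^{2h}\sum_{q_2=0}^{2h}\sum_{j=1}^{2h+1-q_1}\sum_{s=1}^{2h+1-q_2}\sum_{\alpha=1}^{2h+2-q_1-j}B_{q_1}B_{q_2}\binom{2h+1}{q_1}\binom{2h+1}{q_2}\binom{2h+1-q_1}{j}\binom{2h+1-q_2}{s}\\ &\times k^{-4h-2+q_1+q_2+j+s}A_{2h+1-q_1-j,\alpha}\Bigg[\Bigg(\sum_{\substack{\beta=1\\ \alpha+\beta\text{ even}}}^{2h+2-q_2-s}\sum_{c=0}^{\frac{\alpha+\beta}{2}}\sum_{d=0}^{\frac{\alpha+\beta-2c}{2}}(-1)^{c+d+\frac{\alpha+\beta}{2}}A_{2h+1-q_2-s,\beta}\\ &\times\frac{(\alpha+\beta)(\alpha+\beta-c-1)!}{2^{2c+1}c!(\alpha+\beta-2c)!}\binom{\frac{\alpha+\beta-2c}{2}}{d}SIN(\alpha+\beta-2d)\Bigg)\\ &+\Bigg(\sum_{\substack{\beta=1\\ \alpha+\beta\text{ odd}}}^{2h+2-q_2-s}\sum_{e=0}^{\frac{\alpha+\beta-1}{2}}\sum_{f=0}^{\frac{\alpha+\beta-2e-1}{2}}(-1)^{e+f+\frac{\alpha+\beta+1}{2}}A_{2h+1-q_2-s,\beta}\\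 &\times\frac{(\alpha+\beta-e-1)!}{2^{2e+1}e!(\alpha+\beta-2e-1)!}\binom{\frac{\alpha+\beta-2e-1}{2}}{f}SIN(\alpha+\beta-2f-1)\Bigg)\Bigg]. \end{align*}
   Context: A Dirichlet character $\chi$ mod $k$ is odd if $\chi(-1)=-1$; the sum on the left is over all odd Dirichlet characters modulo $k$ (not only primitive ones). $L(s,\chi)=\sum_{n=1}^\infty \chi(n)n^{-s}$ for $\Re(s)>1$. $\phi$ is Euler's totient function. $B_n$ denotes the $n$th Bernoulli number, with the convention $B_0=1$, $B_1=-\frac12$. For integers $q\ge 0$ and $1\le j\le q+1$, $$A_{q,j}:=\sum_{t=0}^{j-1}(-1)^{t+q}\binom{j-1}{t}(j-t)^q .$$ For an integer $n\ge 0$ (with $k$ fixed), $$SIN(n):=\sum_{\substack{1\le m\le k\\ (m,k)=1}}\frac{1}{\left(\sin\left(\frac{\pi m}{k}\right)\right)^{n}},$$ so $SIN(0)=\phi(k)$. *)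

(* Defs.v *)
From HB Require Import structures.
From mathcomp Require Import all_boot all_order all_algebra.
From mathcomp Require Import all_classical all_reals all_analysis.
From mathcomp Require Import complex.

Set Implicit Arguments.
Unset Strict Implicit.
Unset Printing Implicit Defensive.

Import Order.TTheory GRing.Theory Num.Theory.
Import numFieldNormedType.Exports.

Local Open Scope classical_set_scope.
Local Open Scope complex_scope.
Local Open Scope ring_scope.

(* For k > 1, 'Z_k is Z/kZ, so a Dirichlet character mod k is a function on
   'Z_k, evaluated at an integer through its residue class. Pitfall: 'Z_0 and
   'Z_1 are both Z/2Z, so this is only meaningful for k > 1. *)
Definition is_dirichlet_char (R : realType) (k : nat)
    (chi : {ffun 'Z_k -> R[i]}) : Prop :=
  [/\ chi 1 = 1,
      (forall a b : 'Z_k, chi (a * b) = chi a * chi b) &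
      (forall a : 'Z_k, a \isn't a GRing.unit -> chi a = 0)].

Definition odd_dirichlet_chars (R : realType) (k : nat) :
    set {ffun 'Z_k -> R[i]} :=
  [set chi | is_dirichlet_char chi /\ chi (- 1) = - 1].
Arguments odd_dirichlet_chars : clear implicits.

(* n ^ s = exp (s * ln n), for n > 0 and s complex *)
Definition natcpow (R : realType) (n : nat) (s : R[i]) : R[i] :=
  let theta := complex.Im s * ln n%:R in
  (n%:R `^ complex.Re s)%:C * (cos theta +i* sin theta).

(* The series starts at n = 1. The regular module (R[i])^o carries the
   topology of the complex modulus; limn is the value of the sum whenever the
   partial sums converge, in particular for 1 < complex.Re s. *)
Definition dirichlet_L (R : realType) (k : nat) (s : R[i])
    (chi : {ffun 'Z_k -> R[i]}) : R[i] :=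
  limn (series (fun i : nat => chi i.+1%:R * natcpow i.+1 (- s) : (R[i])^o)).

(* [:: B_0; ...; B_n], from B_0 = 1 and
   \sum_(i < m.+2) 'C(m.+2, i) B_i = 0; hence B_1 = - 1/2 *)
Fixpoint bernoulli_seq (n : nat) : seq rat :=
  if n is m.+1 then
    let s := bernoulli_seq m in
    rcons s (- (m.+2%:R)^-1 * \sum_(i < m.+1) 'C(m.+2, i)%:R * s`_i)
  else [:: 1].

Definition bernoulli (n : nat) : rat := (bernoulli_seq n)`_n.

Lemma size_bernoulli_seq n : size (bernoulli_seq n) = n.+1.
Proof. by elim: n => //= n IHn; rewrite size_rcons IHn. Qed.

Lemma nth_bernoulli_seq n i :
  (i <= n)%N -> (bernoulli_seq n)`_i = bernoulli i.
Proof.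
elim: n => [|n IHn]; first by rewrite leqn0 => /eqP->.
rewrite leq_eqVlt => /orP[/eqP-> //|]; rewrite ltnS => le_in.
by rewrite /= nth_rcons size_bernoulli_seq ltnS le_in IHn.
Qed.

Lemma bernoulli0 : bernoulli 0 = 1.
Proof. by []. Qed.

Lemma bernoulli_rec n : \sum_(i < n.+2) 'C(n.+2, i)%:R * bernoulli i = 0.
Proof.
rewrite big_ord_recr /= binSn {2}/bernoulli /= nth_rcons size_bernoulli_seq.
rewrite ltnn eqxx mulrA mulrN divff ?pnatr_eq0 // mulN1r.
apply/eqP; rewrite subr_eq0; apply/eqP; apply: eq_bigr => i _.
by rewrite nth_bernoulli_seq // -ltnS.
Qed.

Lemma bernoulli1 : bernoulli 1 = - 2^-1.
Proof. by rewrite /bernoulli /= big_ord1 /= bin0 !mulr1. Qed.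

Definition A_coef (q j : nat) : int :=
  \sum_(0 <= t < j) (-1) ^+ (t + q) * ('C(j.-1, t) * (j - t) ^ q)%:Z.

Definition SIN (R : realType) (k n : nat) : R :=
  \sum_(1 <= m < k.+1 | coprime m k) (sin (pi * m%:R / k%:R) ^+ n)^-1.

Definition Sigma2 (R : realType) (k h : nat) : R :=
  \sum_(0 <= q1 < (2 * h).+1) \sum_(0 <= q2 < (2 * h).+1)
  \sum_(1 <= j < (2 * h + 1 - q1).+1) \sum_(1 <= s < (2 * h + 1 - q2).+1)
  \sum_(1 <= alpha < (2 * h + 2 - q1 - j).+1)
    ratr (bernoulli q1) * ratr (bernoulli q2)
    * 'C(2 * h + 1, q1)%:R * 'C(2 * h + 1, q2)%:R
    * 'C(2 * h + 1 - q1, j)%:R * 'C(2 * h + 1 - q2, s)%:R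
    * k%:R ^ (- (4 * h)%:Z - 2 + q1%:Z + q2%:Z + j%:Z + s%:Z)
    * (A_coef (2 * h + 1 - q1 - j) alpha)%:~R
    * ((\sum_(1 <= beta < (2 * h + 2 - q2 - s).+1 | ~~ odd (alpha + beta))
        \sum_(0 <= c < ((alpha + beta) %/ 2).+1)
        \sum_(0 <= d < ((alpha + beta - 2 * c) %/ 2).+1)
          (-1) ^+ (c + d + (alpha + beta) %/ 2)
          * (A_coef (2 * h + 1 - q2 - s) beta)%:~R
          * (((alpha + beta) * (alpha + beta - c - 1)`!)%:R
             / (2 ^ (2 * c + 1) * c`! * (alpha + beta - 2 * c)`!)%:R)
          * 'C((alpha + beta - 2 * c) %/ 2, d)%:R
          * SIN R k (alpha + beta - 2 * d))
       + (\sum_(1 <= beta < (2 * h + 2 - q2 - s).+1 | odd (alpha + beta))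
          \sum_(0 <= e < ((alpha + beta - 1) %/ 2).+1)
          \sum_(0 <= f < ((alpha + beta - 2 * e - 1) %/ 2).+1)
            (-1) ^+ (e + f + (alpha + beta + 1) %/ 2)
            * (A_coef (2 * h + 1 - q2 - s) beta)%:~R
            * ((alpha + beta - e - 1)`!%:R
               / (2 ^ (2 * e + 1) * e`! * (alpha + beta - 2 * e - 1)`!)%:R)
            * 'C((alpha + beta - 2 * e - 1) %/ 2, f)%:R
            * SIN R k (alpha + beta - 2 * f - 1))).

(* Main.v *)
Require Import Defs.
From mathcomp Require Import all_boot all_order all_algebra all_fingroup.
From mathcomp Require Import all_classical all_reals all_analysis.
From mathcomp Require Import complex ring lra zify.
Import Order.TTheory GRing.Theory Num.Theory.
Import numFieldNormedType.Exports.
Local Open Scope classical_set_scope.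
Local Open Scope complex_scope.
Local Open Scope ring_scope.

                                                                              
                                                                       
                                                                          
                                                                           
                                                                             
                                                                                 
                                                                                
                                                     
                                                                          
                                                            
                                                                            
                                                                             
                                                                
                                                                                
                                                             

(** Both sides are explicit multiples of T, the sum over m coprime to k of c(m)^2, where c(m) is the
    derivative of order 2h of the cotangent at pi m / k.

    Left side. Grouping n by residue class gives L(2h+1, chi) = sum_a chi(a) S(a), with S(a) the sum
    of n^-(2h+1) over n congruent to a ([dirichlet_L_residue_sum]). Orthogonality of characters
    turns the mean square over odd chi into phi(k)/4 times the sum of (S(u) - S(-u))^2 over units u
    ([sum_odd_dirichlet_chars]). The difference S(m) - S(-m) is the partial fraction series of a
    derivative of the cotangent, so it equals (pi/k)^(2h+1) / (2h)! times c(m) ([residue_sum_sub]).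
    That series is obtained by real analysis alone: the duplication formula 2 cot 2v = cot v - tan v
    is differentiated and iterated, and every term is then compared with its pole
    ([cot_deriv_partial_fractions]).

    Right side. Put w = 1/(e^(2 pi i m/k) - 1) = -1/2 - (i/2) cot(pi m/k). Expanding cos nx and sin
    nx in powers of cos x and sin x shows that the [SIN] brackets of [Sigma2] are the numbers A
    times sums over m of Re w^(alpha+beta). Hence [Sigma2] is the sum over m of Re G(m)^2 for one
    finite sum G(m) ([Sigma2_Re_sqr]). The Bernoulli recurrence collapses G(m) to (2h+1) k^(-2h)
    A_{2h}(w), where A_q is the polynomial with coefficients A_{q,j} ([bernoulli_contraction],
    [Sigma2_inner_sum]). Since A_q(w) is the derivative of order q of w = 1/(e^u - 1) in u,
    A_{2h}(w) = (-i/2)^(2h+1) c(m). This is purely imaginary, whence the minus sign of the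
    theorem. *)

(** * Bernoulli numbers and the collapse of the binomial double sum *)

Lemma bin_trinomial n m p : (m + p <= n)%N ->
  ('C(n, p) * 'C(n - p, m) = 'C(n, m) * 'C(n - m, p))%N.
Proof.
move=> le_mpn.
have Dpos : (0 < p`! * m`! * (n - p - m)`!)%N by rewrite !muln_gt0 !fact_gt0.
apply/eqP; rewrite -(eqn_pmul2r Dpos); apply/eqP.
have e1 : ('C(n, p) * (p`! * (n - p)`!) = n`!)%N by apply: bin_fact; lia.
have e2 : ('C(n - p, m) * (m`! * (n - p - m)`!) = (n - p)`!)%N by apply: bin_fact; lia.
have e3 : ('C(n, m) * (m`! * (n - m)`!) = n`!)%N by apply: bin_fact; lia.
have e4 : ('C(n - m, p) * (p`! * (n - m - p)`!) = (n - m)`!)%N by apply: bin_fact; lia.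
rewrite subnAC in e4; transitivity (n`!); first by rewrite -e1 -e2; ring.
by rewrite -e3 -e4; ring.
Qed.

Lemma bernoulli_sum n :
  \sum_(i < n) 'C(n, i)%:R * bernoulli i = (n == 1%N)%:R.
Proof.
case: n => [|[|n]]; first by rewrite big_ord0.
  by rewrite big_ord1 bernoulli0 mulr1.
by rewrite bernoulli_rec.
Qed.

(** Collect the terms with the same m = s - q - j. Trinomial revision pulls out 'C(s, m), and what
    remains is the sum of 'C(s - m, q) B_q over q < s - m, which vanishes unless s - m = 1. *)
Lemma bernoulli_contraction (F : numFieldType) (s : nat) (c : nat -> F) :
  (0 < s)%N ->
  \sum_(0 <= q < s) \sum_(1 <= j < (s - q).+1)
    ratr (bernoulli q) * 'C(s, q)%:R * 'C(s - q, j)%:R * c (s - q - j)%N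
  = s%:R * c s.-1.
Proof.
move=> s0.
(* Substitute m = s - q - j. The condition j >= 1 becomes q + m < s, which is exactly the range of q
   in the Bernoulli recurrence. *)
transitivity (\sum_(q < s) \sum_(m < s | (q + m < s)%N)
    ratr (bernoulli q) * 'C(s, q)%:R * 'C(s - q, m)%:R * c m).
  rewrite big_mkord; apply: eq_bigr => q _.
  rewrite big_add1 /= big_nat_rev /=.
  rewrite -(big_mkord (fun m => q + m < s)%N
    (fun m => ratr (bernoulli q) * 'C(s, q)%:R * 'C(s - q, m)%:R * c m)).
  rewrite (big_cat_nat (leq0n (s - q)) (leq_subr _ _)) /=.
  rewrite [X in _ = _ + X]big_nat_cond [X in _ = _ + X]big1 ?addr0; last first.
    by move=> i; lia.
  rewrite [RHS]big_nat_cond [LHS]big_nat_cond.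
  apply: eq_big => [m|m]; first by lia.
  move=> /andP[/andP[_ lt_m] _].
  have -> : (0 + (s - q) - m.+1).+1 = (s - q - m)%N by lia.
  by rewrite bin_sub ?(ltnW lt_m)// subKn// ltnW.
rewrite (exchange_big_dep predT) //=.
transitivity (\sum_(m < s) 'C(s, m)%:R * c m * (s - m == 1)%N%:R).
  apply: eq_bigr => m _.
  rewrite -(ratr_nat F (s - m == 1)%N) -bernoulli_sum rmorph_sum mulr_sumr.
  rewrite -(big_mkord xpredT (fun q => 'C(s, m)%:R * c m *
     ratr ('C(s - m, q)%:R * bernoulli q))).
  rewrite -(big_mkord (fun q => (q + m < s)%N) (fun q =>
      ratr (bernoulli q) * 'C(s, q)%:R * 'C(s - q, m)%:R * c m)).
  rewrite (big_cat_nat (leq0n (s - m)) (leq_subr _ _)) /=.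
  rewrite [X in _ + X = _]big_nat_cond [X in _ + X = _]big1 ?addr0; last first.
    by move=> i; lia.
  rewrite [RHS]big_nat_cond [LHS]big_nat_cond.
  apply: eq_big => [q|q]; first by lia.
  move=> /andP[/andP[_ lt_q] _].
  rewrite rmorphM /= ratr_nat.
  have := @bin_trinomial s m q; move/(_ ltac:(lia)) => /(congr1 (fun n => n%:R : F)).
  rewrite !natrM => e.
  transitivity (ratr (bernoulli q) * c m * ('C(s, q)%:R * 'C(s - q, m)%:R)).
    by ring.
  by rewrite e; ring.
case: s s0 => // s _.
rewrite big_ord_recr /= subSnn eqxx mulr1 binSn big1 ?add0r // => m _.
by rewrite (_ : (_ == _) = false) ?mulr0 //; have := ltn_ord m; lia.
Qed.

(** * The numbers A_{q,j} and the derivatives of the cotangent as polynomials *)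

Lemma A_coef0 j : A_coef 0 j = (j == 1%N)%:R.
Proof.
case: j => [|j]; first by rewrite /A_coef big_geq.
rewrite /A_coef /= eqSS.
transitivity (\sum_(i < j.+1) ((1 : int) ^+ (j - i) * (-1) ^+ i *+ 'C(j, i))).
  rewrite big_mkord; apply: eq_bigr => i _.
  by rewrite addn0 expr1n mul1r expn0 muln1 -natz mulr_natr.
by rewrite -exprDn addrC subrr expr0n.
Qed.

Lemma A_coefS q j :
  A_coef q.+1 j.+1 = - (j.+1%:Z * A_coef q j.+1 + j%:Z * A_coef q j).
Proof.
rewrite /A_coef /= !mulr_sumr.
case: j => [|j].
  rewrite !big_nat1 big_geq // !add0n !subn0 !exp1n exprS; ring.
(* Absorption, t 'C(j+1, t) = (j+1) 'C(j, t-1), together with a shift of t gives both sums the same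
   powers (j + 2 - t)^q. The recurrence then holds term by term. *)
rewrite [X in _ + X](_ : _ = - \sum_(0 <= t < j.+2)
  (-1) ^+ (t + q) * (t * 'C(j.+1, t) * (j.+2 - t) ^ q)%N%:Z); last first.
  rewrite [in RHS]big_nat_recl //= !mul0n mulr0 add0r -sumrN.
  apply: eq_big_nat => t _; rewrite -mul_bin_diag subSS addSn exprS !PoszM /=; ring.
rewrite opprD opprK -sumrN -big_split /=; apply: eq_big_nat => t /andP[_ lt_t].
rewrite addnS exprS expnS !PoszM -subzn; last by lia.
ring.
Qed.

Lemma A_coef_gt q j : (q.+1 < j)%N -> A_coef q j = 0.
Proof.
elim: q j => [|q IHq] [|j] // lt_qj; first by rewrite A_coef0 (gtn_eqF lt_qj).
by rewrite A_coefS !IHq ?mulr0 ?addr0 ?oppr0 // ltnW.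
Qed.

(** For w = 1/(e^u - 1) one has dw/du = -(w + w^2), so by [A_polyS] the value of this polynomial at
    w is the derivative of order q of w in u. The bound on j loses nothing, by [A_coef_gt]. *)
Definition A_poly (F : comNzRingType) (q : nat) : {poly F} :=
  \poly_(j < q.+2) (A_coef q j)%:~R.

Lemma coef_A_poly (F : comNzRingType) q j :
  (A_poly F q)`_j = (A_coef q j)%:~R.
Proof.
by rewrite coef_poly; case: ltnP => // /A_coef_gt ->.
Qed.

Lemma A_poly0 (F : comNzRingType) : A_poly F 0 = 'X.
Proof. by apply/polyP => j; rewrite coef_A_poly A_coef0 coefX; case: (j == 1%N). Qed.

Lemma A_polyS (F : comNzRingType) q :
  A_poly F q.+1 = - (('X + 'X^2) * (A_poly F q)^`()).
Proof.
apply/polyP => j; rewrite coef_A_poly expr2 mulrDl -mulrA coefN coefD !coefXM.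
case: j => [|j] /=; first by rewrite /A_coef big_geq // addr0 oppr0.
rewrite coef_deriv coef_A_poly A_coefS.
case: j => [|j] /=; first by rewrite mul0r !addr0 mul1r mulr1n rmorphN.
rewrite coef_deriv coef_A_poly rmorphN rmorphD; congr (- (_ + _)).
  by rewrite rmorphM mulr_natl.
by rewrite rmorphM mulr_natl.
Qed.

Lemma horner_A_poly (F : comNzRingType) q (w : F) :
  (A_poly F q).[w] = \sum_(1 <= j < q.+2) (A_coef q j)%:~R * w ^+ j.
Proof.
rewrite horner_poly -(big_mkord xpredT (fun j => (A_coef q j)%:~R * w ^+ j)).
have A0 : A_coef q 0 = 0 by rewrite /A_coef big_geq.
by rewrite big_nat_recl // A0 mul0r add0r big_add1.
Qed.

(** Since cot' = -(1 + cot^2), evaluating at cot u gives the derivative of order q of the cotangent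
    at u. *)
Fixpoint cot_poly (F : comNzRingType) (q : nat) : {poly F} :=
  if q is q'.+1 then - ((1 + 'X^2) * (cot_poly F q')^`()) else 'X.

                                                                            
                                                             
(** The substitution w = a X - 1/2 turns w + w^2 into a^2 (1 + X^2), so the two recurrences agree up
    to one factor a per derivative. The case in view is a = -i/2, from 1/(e^(2ix) - 1) = -1/2 -
    (i/2) cot x. *)
Lemma A_poly_cot_poly (F : fieldType) (q : nat) (a b : F) :
  a ^+ 2 = - (2%:R^-1) ^+ 2 -> b = - 2%:R^-1 -> (2%:R : F) != 0 -> (0 < q)%N ->
  A_poly F q \Po (a *: 'X + b%:P) = a ^+ q.+1 *: cot_poly F q.
Proof.
move=> a2 -> two0; set l := _ + _.
have dl : l^`() = a%:P by rewrite /l derivD derivZ derivX derivC addr0 alg_polyC.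
have l2 : l + l ^+ 2 = (a ^+ 2)%:P * (1 + 'X^2).
  rewrite /l -mul_polyC.
  have e : (2%:R^-1)%:P + (2%:R^-1)%:P = 1 :> {poly F}.
    by rewrite -polyCD; congr _%:P; field.
  have e2 : (a ^+ 2)%:P = - ((2%:R^-1)%:P ^+ 2) :> {poly F}.
    by rewrite a2 polyCN polyC_exp.
  rewrite polyCN !polyC_exp in e2 *.
  move: (a%:P) ((2%:R^-1)%:P) e e2 => x y e e2.
  transitivity (x ^+ 2 * 'X^2 + (1 - (y + y)) * (x * 'X) + y * (y - 1)); first by ring.
  have -> : y * (y - 1) = x ^+ 2 by rewrite e2 -e; ring.
  by rewrite e subrr; ring.
(* At order 0 the identity is off by the constant -1/2, but the derivatives already agree; the
   induction therefore carries the derivatives. *)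
have D q' : (A_poly F q')^`() \Po l = a ^+ q' *: (cot_poly F q')^`() /\
  ((0 < q')%N -> A_poly F q' \Po l = a ^+ q'.+1 *: cot_poly F q').
  elim: q' => [|q' [IH _]]; first by rewrite A_poly0 derivX comp_polyC scale1r.
  have e : A_poly F q'.+1 \Po l = a ^+ q'.+2 *: cot_poly F q'.+1.
    rewrite A_polyS raddfN /= comp_polyM raddfD /= comp_polyX rmorphXn /= comp_polyX.
    by rewrite l2 IH -!mul_polyC !exprS !polyCM; ring.
  split=> //; have a0 : a != 0.
    by apply: contra_eq_neq a2 => ->; rewrite expr0n eq_sym oppr_eq0 expf_eq0 invr_eq0.
  have := congr1 (fun p : {poly F} => p^`()) e; rewrite deriv_comp dl derivZ.
  move=> /(congr1 (fun p => (a^-1)%:P * p)).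
  rewrite mulrCA -polyCM mulVf // mulr1 => ->.
  by rewrite mul_polyC scalerA exprS mulKf.
by case: (D q) => _; apply.
Qed.

Lemma map_cot_poly (F K : comNzRingType) (f : {rmorphism F -> K}) q :
  map_poly f (cot_poly F q) = cot_poly K q.
Proof.
elim: q => [|q IHq]; first by rewrite map_polyX.
by rewrite /= rmorphN rmorphM rmorphD rmorph1 rmorphXn /= map_polyX -deriv_map IHq.
Qed.

(** The leading coefficient is that of the derivative of order q of 1/u, the polar part of the
    cotangent at 0. *)
Lemma cot_poly_coef (F : comNzRingType) q :
  (size (cot_poly F q) <= q.+2)%N /\ (cot_poly F q)`_q.+1 = (-1) ^+ q * q`!%:R.
Proof.
elim: q => [|q [IHs IHc]]; first by rewrite size_polyX coefX expr0 mulr1.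
have c j : (cot_poly F q.+1)`_j.+2 =
    - ((cot_poly F q)`_j.+3 *+ j.+3 + (cot_poly F q)`_j.+1 *+ j.+1).
  by rewrite /= coefN mulrDl mul1r coefD coefXnM /= !coef_deriv subn2.
split.
  apply/leq_sizeP => -[|[|j]] // lt_j.
  rewrite c !nth_default ?mul0rn ?addr0 ?oppr0 //.
    exact: leq_trans IHs (lt_j : (q.+2 <= j.+1)%N).
  exact: leq_trans IHs (leqW (leqW (lt_j : (q.+2 <= j.+1)%N))).
rewrite c [X in X *+ _]nth_default ?mul0rn ?add0r; last first.
  exact: leq_trans IHs (leqnSn _).
by rewrite IHc factS exprS natrM -mulr_natr; ring.
Qed.

Lemma cot_poly_comp_opp (F : comNzRingType) q :
  cot_poly F q \Po (- 'X) = (-1) ^+ q.+1 * cot_poly F q.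
Proof.
elim: q => [|q IHq]; first by rewrite comp_polyX expr1 mulN1r.
rewrite /= raddfN /= comp_polyM raddfD /= rmorphXn /= comp_polyX comp_polyC.
rewrite sqrrN.
have := congr1 (fun p : {poly F} => p^`()) IHq; rewrite deriv_comp derivN derivX.
rewrite derivM -(rmorphN1 (polyC : F -> {poly F})) -rmorphXn derivC mul0r add0r.
rewrite rmorphXn rmorphN1 mulrN1 => /(congr1 -%R); rewrite opprK => ->.
by rewrite [in RHS]exprS; ring.
Qed.

Lemma horner_cot_polyN (F : comNzRingType) q (y : F) :
  (cot_poly F q).[- y] = (-1) ^+ q.+1 * (cot_poly F q).[y].
Proof.
have := congr1 (horner^~ y) (cot_poly_comp_opp F q).
by rewrite horner_comp !hornerE => ->.
Qed.

                                                   
                                             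
(** * Duplication, and partial fractions for the derivatives of the cotangent *)

(** This is 2 cot 2v = cot v + cot(v + pi/2) differentiated q times, with y = cot v and -1/y = cot(v
    + pi/2). The induction differentiates in y and multiplies by -(1 + y^2). *)
Lemma cot_poly_duplication {R : realType} {q} {y : R} : y != 0 ->
  2 ^+ q.+1 * (cot_poly R q).[(y - y^-1) / 2]
  = (cot_poly R q).[y] + (cot_poly R q).[- y^-1].
Proof.
elim: q y => [|q IHq] y y0; first by rewrite /= !hornerX; field.
set p := cot_poly R q in IHq *.
have h1 : is_derive y (1 : R) (fun z : R => 2 ^+ q.+1 * p.[(z - z^-1) / 2])
    (2 ^+ q.+1 * (p^`().[(y - y^-1) / 2] * ((1 + y ^- 2) / 2))).
  have hi : is_derive y (1 : R) (fun z : R => (z - z^-1) / 2) ((1 + y ^- 2) / 2).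
    have hv : is_derive y (1 : R) (fun z : R => z^-1) (- y ^- 2).
      have := @is_deriveV R id y 1 1 y0 _; rewrite scaler1; apply.
    have -> : (fun z : R => (z - z^-1) / 2) = (2^-1 : R) \*: (id - (fun z => z^-1)).
      by apply/funext => z /=; rewrite !fctE mulrC.
    apply: (trigger_derive (is_deriveZ (2^-1 : R) (is_deriveB (is_derive_id y 1) hv))).
    by rewrite opprK -[LHS]/(_ * _) mulrC.
  have hc := @is_derive1_comp R (horner p) _ y _ _ (is_derive_poly _ _) hi.
  exact: (trigger_derive (is_deriveZ (2 ^+ q.+1 : R) hc)).
have h2 : is_derive y (1 : R) (fun z : R => p.[z] + p.[- z^-1])
   (p^`().[y] + p^`().[- y^-1] * y ^- 2).
  have hv : is_derive y (1 : R) (fun z : R => - z^-1) (y ^- 2).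
    have := @is_deriveV R id y 1 1 y0 _; rewrite scaler1 => H.
    have := is_deriveN (H _); rewrite opprK; apply.
  have hc := @is_derive1_comp R (horner p) _ y _ _ (is_derive_poly _ _) hv.
  exact: is_deriveD (is_derive_poly p y) hc.
(* The induction hypothesis excludes 0, so it is used as an equality near y, which suffices to
   identify the derivatives. *)
have near0 : \forall z \near y, p.[z] + p.[- z^-1] = 2 ^+ q.+1 * p.[(z - z^-1) / 2].
  have : \forall z \near y, z != 0 by apply: open_nbhs_nbhs; split=> //; exact: open_neq.
  by apply: filterS => z z0; rewrite IHq.
have e : 2 ^+ q.+1 * (p^`().[(y - y^-1) / 2] * ((1 + y ^- 2) / 2)) =
    p^`().[y] + p^`().[- y^-1] * y ^- 2.
  have h2' := near_eq_is_derive near0 h2.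
  by rewrite -(@derive_val _ _ _ _ _ _ _ h1) (@derive_val _ _ _ _ _ _ _ h2').
rewrite /= -/p !hornerE.
transitivity (- (1 + y ^+ 2) * (2 ^+ q.+1 * (p^`().[(y - y^-1) / 2] * ((1 + y ^- 2) /
  2)))).
  by rewrite [2 ^+ q.+2]exprS; field.
by rewrite e; field.
Qed.

Definition cot {R : realType} (u : R) : R := cos u / sin u.

Definition cot_deriv {R : realType} (q : nat) (t : R) : R :=
  (cot_poly R q).[cot (pi * t)].

(** With v = pi t / 2, the second point is -1/y = -cot(pi/2 - v). For even q the polynomial is odd,
    which makes the second term a subtracted value at (1 - t)/2. *)
Lemma cot_deriv_duplication {R : realType} {q : nat} {t : R} : ~~ odd q ->
  0 < t < 1 ->
  2 ^+ q.+1 * cot_deriv q t = cot_deriv q (t / 2) - cot_deriv q ((1 - t) / 2).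
Proof.
move=> q_even /andP[t0 t1]; rewrite /cot_deriv.
set v := pi * (t / 2).
have pi0 := pi_gt0 R.
have vI : 0 < v < pi / 2.
  by rewrite /v mulrA divr_gt0 ?mulr_gt0 // ltr_pM2r // gtr_pMr.
have s0 : 0 < sin v by apply: sin_gt0_pihalf.
have c0 : 0 < cos v.
  by apply: cos_gt0_pihalf; case/andP: vI => *; rewrite (lt_trans _ (_ : 0 < v))
    ?oppr_lt0 ?divr_gt0.
have -> : pi * t = v *+ 2 by rewrite /v; field.
have -> : pi * ((1 - t) / 2) = pi / 2 - v by rewrite /v; field.
set y := cot v.
have y0 : y != 0 by rewrite /y /cot mulf_neq0 ?invr_eq0 ?gt_eqF.
have -> : cot (pi / 2 - v) = y^-1.
  by rewrite /y /cot addrC cosDpihalf sinDpihalf sinN cosN opprK invf_div.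
have -> : cot (v *+ 2) = (y - y^-1) / 2.
  rewrite /y /cot.
  have -> : cos (v *+ 2) = cos v ^+ 2 - sin v ^+ 2.
    by rewrite cos_mulr2n sin2cos2; ring.
  by rewrite sin_mulr2n; field; rewrite ?gt_eqF.
rewrite cot_poly_duplication // [X in _ + X]horner_cot_polyN -signr_odd /= q_even.
by rewrite expr1 mulN1r.
Qed.

Lemma cot_deriv_iter (R : realType) (q m : nat) (t : R) : ~~ odd q ->
  0 < t < 1 ->
  (2 ^+ m.+1) ^+ q.+1 * cot_deriv q t =
  \sum_(j < 2 ^ m) (cot_deriv q ((j%:R + t) / 2 ^+ m.+1)
                    - cot_deriv q ((j%:R + (1 - t)) / 2 ^+ m.+1)).
Proof.
move=> q_even /andP[t0 t1].
elim: m => [|m IHm].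
  by rewrite big_ord1 expr1 !add0r cot_deriv_duplication ?t0.
set N : R := 2 ^+ m.+1 in IHm *.
have N0 : 0 < N by rewrite exprn_gt0.
have NE : N = (2 ^ m.+1)%:R by rewrite natrX.
rewrite [2 ^+ m.+2]exprS -/N exprMn -mulrA IHm mulr_sumr.
pose F r := cot_deriv q (r / (2 * N)).
(* Halving (j + r)/N produces the point (j + r)/(2N) and its reflection, whose index 2^(m+1) - j - 1
   lies in the upper half. Exchanging the two reflected terms then restores the shape of the
   summand. *)
transitivity (\sum_(j < 2 ^ m)
    ((F (j%:R + t) - F ((2 ^ m.+1 - j.+1)%:R + (1 - t)))
     + (F ((2 ^ m.+1 - j.+1)%:R + t) - F (j%:R + (1 - t))))).
  apply: eq_bigr => j _.
  have lej : (j.+1 <= 2 ^ m.+1)%N by rewrite expnS; have := ltn_ord j; lia.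
  have lejR : j%:R + 1 <= N by rewrite NE natr1 ler_nat.
  have j0 : (0 : R) <= j%:R by [].
  have e r : 0 < r < 1 -> 2 ^+ q.+1 * cot_deriv q ((j%:R + r) / N) =
      F (j%:R + r) - F ((2 ^ m.+1 - j.+1)%:R + (1 - r)).
    move=> /andP[r0 r1]; rewrite cot_deriv_duplication //; last first.
      by rewrite divr_gt0 // ?ltr_pdivrMr //=; lra.
    rewrite natrB // -NE -natr1 /F; congr (cot_deriv q _ - cot_deriv q _); field; lra.
  by rewrite mulrBr !e ?t0 // ?subr_gt0 ?t1 ?gtrBl //= subKr opprB.
rewrite (eq_bigr (fun j : 'I_(2 ^ m) => (F (j%:R + t) - F (j%:R + (1 - t))) +
   (F ((2 ^ m.+1 - j.+1)%:R + t) - F ((2 ^ m.+1 - j.+1)%:R + (1 - t))))); last first.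
  by move=> j _; ring.
rewrite big_split /= -(big_mkord xpredT (fun j => F (j%:R + t) - F (j%:R + (1 - t)))).
rewrite -(big_mkord xpredT (fun j => F ((2 ^ m.+1 - j.+1)%:R + t) - F ((2 ^ m.+1 -
  j.+1)%:R + (1 - t)))).
rewrite -[RHS](big_mkord xpredT (fun j => F (j%:R + t) - F (j%:R + (1 - t)))).
rewrite [RHS](@big_cat_nat _ _ _ (2 ^ m)) //=; last by rewrite leq_exp2l.
congr (_ + _).
have e : (2 ^ m.+1 - 2 ^ m = 2 ^ m)%N by rewrite expnS mul2n -addnn addnK.
rewrite -[in RHS](add0n (2 ^ m)%N) big_addn e big_nat_rev /=.
apply: eq_big_nat => j /andP[_ lt_j].
by have -> : (2 ^ m.+1 - (0 + 2 ^ m - j.+1).+1 = j + 2 ^ m)%N by lia.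
Qed.

Lemma derive_ge0_le {R : realType} {f df : R -> R} {b u : R} :
  (forall x : R, is_derive x 1 f (df x)) ->
  (forall x, 0 < x < b -> 0 <= df x) -> 0 < u <= b -> f 0 <= f u.
Proof.
move=> fdf df0 /andP[u0 ub].
have cf : {within `[0, u], continuous f}.
  apply: continuous_subspaceT => x.
  by apply/differentiable_continuous/derivable1_diffP; case: (fdf x).
have [c] := MVT u0 (fun x _ => fdf x) cf.
rewrite in_itv /= => /andP[c0 cu]; rewrite subr0 -subr_ge0 => ->.
by rewrite mulr_ge0 ?(ltW u0) // df0 // c0 (lt_le_trans cu).
Qed.

(** The difference is -(sin u - u cos u)/(u sin u). Its numerator lies between 0 and 2 u sin u
    because both gaps vanish at 0 and have derivatives x sin x and 2 x cos x + (2 - x) sin x,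
    nonnegative as pi/2 < 2. *)
Lemma norm_cot_sub_inv (R : realType) (u : R) : 0 < u <= pi / 2 ->
  `|cot u - u^-1| <= 2.
Proof.
move=> uI; have /andP[u0 u1] := uI.
have pi2 := pihalf_lt2 R.
have s0 x : 0 < x < pi / 2 -> 0 <= sin x by move=> /sin_gt0_pihalf /ltW.
have c0 x : 0 < x < pi / 2 -> 0 <= cos x.
  by move=> xI; apply: cos_ge0_pihalf; lra.
have su : 0 < sin u by apply: sin_gt0_pi; have := pi_gt0 R; lra.
have lo : 0 <= sin u - u * cos u.
  have d x : is_derive x (1 : R) (fun x => sin x - x * cos x) (x * sin x).
    have := is_deriveB (is_derive_sin x) (is_deriveM (is_derive_id x 1)
      (is_derive_cos x)).
    move=> H; apply: (trigger_derive H); rewrite -![_ *: _]/(_ * _); ring.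
  have := derive_ge0_le d _ uI; rewrite sin0 mul0r subr0; apply.
  by move=> x xI; rewrite mulr_ge0 ?s0 //; lra.
have hi : 0 <= 2 * (u * sin u) - (sin u - u * cos u).
  have d x : is_derive x (1 : R) (fun x => 2 * (x * sin x) - (sin x - x * cos x))
     (2 * (x * cos x) + (2 - x) * sin x).
    have := is_deriveB (is_deriveZ (2 : R) (is_deriveM (is_derive_id x 1)
      (is_derive_sin x)))
     (is_deriveB (is_derive_sin x) (is_deriveM (is_derive_id x 1) (is_derive_cos x))).
    move=> H; apply: (trigger_derive H); rewrite -![_ *: _]/(_ * _); ring.
  have := derive_ge0_le d _ uI; rewrite sin0 !mul0r mulr0 !subr0; apply.
  by move=> x xI; rewrite addr_ge0 ?mulr_ge0 ?s0 ?c0 //; lra.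
rewrite /cot.
have -> : cos u / sin u - u^-1 = - ((sin u - u * cos u) / (u * sin u)).
  by field; rewrite ?gt_eqF.
have us0 : 0 < u * sin u by rewrite mulr_gt0.
rewrite normrN ger0_norm; last by rewrite divr_ge0 // ltW.
by rewrite ler_pdivrMr // -subr_ge0.
Qed.

                                                                             
(** To be used with y = cot u and v = 1/u: a bounded error in the argument, like the lower
    coefficients, costs only one order in v. The bound 1 <= 2 v lets higher powers of v dominate
    lower ones. Induction peels off the constant term, p = q X + p_0. *)
Lemma horner_leading_estimate (R : realFieldType) (n : nat) (p : {poly R}) (K : R) :
  (size p <= n.+2)%N -> 0 <= K ->
  exists2 C, 0 <= C & forall y v : R, `|y - v| <= K -> 1 <= 2 * v ->
    `|p.[y] - p`_n.+1 * v ^+ n.+1| <= C * v ^+ n.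
Proof.
elim: n p => [|n IHn] p sp K0.
  exists (`|p`_1| * K + `|p`_0|) => [|y v yv v1].
    by rewrite addr_ge0 ?mulr_ge0.
  rewrite (horner_coef_wide _ sp) 2!big_ord_recl big_ord0 /= !expr1 !expr0 !mulr1 addr0.
  have -> : p`_0 + p`_1 * y - p`_1 * v = p`_1 * (y - v) + p`_0 by ring.
  by rewrite (le_trans (ler_normD _ _)) // lerD2r normrM ler_wpM2l.
pose q : {poly R} := \poly_(i < n.+2) p`_i.+1.
have pE : p = q * 'X + (p`_0)%:P.
  apply/polyP => -[|i]; rewrite coefD coefMX coefC /= ?add0r // addr0 coef_poly.
  by case: ltnP => // ni; rewrite nth_default // (leq_trans sp).
have [C C0 HC] := IHn q (size_poly _ _) K0.
(* The summands bound the three pieces of p(y) below, using |y| <= (1 + 2K) v and 1 <=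
   (2v)^(n+1). *)
exists (C * (1 + 2 * K) + `|q`_n.+1| * K + `|p`_0| * 2 ^+ n.+1) => [|y v yv v1].
  by rewrite !addr_ge0 ?mulr_ge0 ?exprn_ge0 //; lra.
have v0 : 0 < v by lra.
have q1 : p`_n.+2 = q`_n.+1 by rewrite coef_poly ltnSn.
have -> : p.[y] - p`_n.+2 * v ^+ n.+2 =
    (q.[y] - q`_n.+1 * v ^+ n.+1) * y + q`_n.+1 * v ^+ n.+1 * (y - v) + p`_0.
  by rewrite q1 {1}pE hornerD hornerMX hornerC !exprS; ring.
rewrite (le_trans (ler_normD _ _)) // [leRHS]mulrDl lerD //; last first.
  by rewrite -mulrA ler_peMr // -exprMn exprn_ege1.
rewrite (le_trans (ler_normD _ _)) // [leRHS]mulrDl lerD //.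
  have yb : `|y| <= (1 + 2 * K) * v.
    have -> : y = (y - v) + v by ring.
    rewrite (le_trans (ler_normD _ _)) // (gtr0_norm v0); nra.
  have -> : C * (1 + 2 * K) * v ^+ n.+1 = (C * v ^+ n) * ((1 + 2 * K) * v).
    by rewrite exprS; ring.
  by rewrite normrM ler_pM // HC.
rewrite 2!normrM [X in _ * X * _]ger0_norm; last by rewrite exprn_ge0 // ltW.
by rewrite mulrAC ler_wpM2r // ?exprn_ge0 ?ler_wpM2l // ltW.
Qed.

Lemma cot_deriv_estimate (R : realType) (q : nat) :
  exists2 C : R, 0 <= C & forall t, 0 < t <= 1 / 2 ->
    `|cot_deriv q t - (-1) ^+ q * q`!%:R * (pi * t) ^- q.+1| <= C * (pi * t) ^- q.
Proof.
have [sz lc] := cot_poly_coef R q.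
have [C C0 HC] := horner_leading_estimate R q _ 2 sz (ler0n R 2).
exists C => // t /andP[t0 t1].
have pi0 := pi_gt0 R; have pi2 := pihalf_lt2 R.
have v0 : 0 < pi * t by rewrite mulr_gt0.
have v1 : pi * t <= pi / 2 by rewrite ler_pM2l //; lra.
rewrite -!exprVn -lc HC //; first by rewrite norm_cot_sub_inv // v0.
by rewrite -ler_pdivrMr // ?invr_gt0 //; lra.
Qed.

Lemma sum_inv_sqr_le (R : realType) (n : nat) :
  \sum_(i < n) (i.+1%:R : R) ^- 2 <= 2.
Proof.
case: n => [|n]; first by rewrite big_ord0.
suff : \sum_(i < n.+1) (i.+1%:R : R) ^- 2 <= 2 - n.+1%:R^-1.
  by move=> /le_trans; apply; rewrite gerBl invr_ge0.
elim: n => [|n IHn]; first by rewrite big_ord1 expr1n invr1; lra.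
rewrite big_ord_recr /= (le_trans (lerD IHn (lexx _))) //.
have n0 : (0 : R) < n.+1%:R by rewrite ltr0n.
rewrite -[n.+2%:R]natr1; set x : R := n.+1%:R in n0 *.
rewrite -subr_ge0.
have -> : 2 - (x + 1)^-1 - (2 - x^-1 + (x + 1) ^- 2) = (x * (x + 1) ^+ 2)^-1.
  by field; lra.
by rewrite invr_ge0 mulr_ge0 ?exprn_ge0 //; lra.
Qed.

(** For t <= 1 one has j + t >= t (j + 1), which reduces the sum to that of the inverse squares. *)
Lemma sum_inv_exp_le (R : realType) (n q : nat) (t : R) : (2 <= q)%N -> 0 < t <= 1 ->
  \sum_(j < n) (j%:R + t) ^- q <= t ^- q * 2.
Proof.
move=> q2 /andP[t0 t1].
apply: le_trans (ler_wpM2l _ (sum_inv_sqr_le R n)); last by rewrite invr_ge0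
  exprn_ge0 // ltW.
rewrite mulr_sumr; apply: ler_sum => j _.
have j1 : (1 : R) <= j.+1%:R by rewrite ler1n.
have jE : (j.+1%:R : R) = j%:R + 1 by rewrite natr1.
have j0 : (0 : R) <= j%:R by [].
apply: (@le_trans _ _ (t ^- q * j.+1%:R ^- q)); last first.
  have tq0 : 0 <= t ^- q by rewrite invr_ge0 exprn_ge0 // ltW.
  rewrite ler_wpM2l // lef_pV2 ?posrE ?exprn_gt0 ?ler_weXn2l //; lra.
rewrite -invfM -exprMn lef_pV2 ?posrE ?exprn_gt0 ?mulr_gt0 //; try lra.
rewrite lerXn2r ?nnegrE //; [| |rewrite jE]; nra.
Qed.

                                                                            
                                                                         
(** In [cot_deriv_iter], with N = 2^(m+1), each term is replaced by its pole. The errors are of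
    order (pi/N)^(-q) times a sum bounded because q >= 2, and the normalising factor (pi/N)^(q+1)
    makes the total O(1/N). Only truncations at powers of two occur, as the duplication dictates. *)
Lemma cot_deriv_partial_fractions (R : realType) (q : nat) (t : R) :
  ~~ odd q -> (2 <= q)%N -> 0 < t < 1 ->
  (\sum_(j < 2 ^ m) ((j%:R + t) ^- q.+1 - (j%:R + (1 - t)) ^- q.+1)
    @[m --> \oo] --> pi ^+ q.+1 / q`!%:R * cot_deriv q t)%classic.
Proof.
move=> q_even q2 tI; have /andP[t0 t1] := tI.
have [C C0 HC] := cot_deriv_estimate R q.
have pi0 := pi_gt0 R.
pose S m := \sum_(j < 2 ^ m) ((j%:R + t) ^- q.+1 - (j%:R + (1 - t)) ^- q.+1).
pose K := pi * C * (t ^- q * 2 + (1 - t) ^- q * 2) / q`!%:R.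
have L0 : (0 : R) < q`!%:R by rewrite ltr0n fact_gt0.
have key m : `|pi ^+ q.+1 / q`!%:R * cot_deriv q t - S m| <= K * (1 / 2) ^+ m.
  set N : R := 2 ^+ m.+1.
  have N0 : 0 < N by rewrite exprn_gt0.
  (* As j < 2^m, the point (j + r)/N is at most 1/2, so [cot_deriv_estimate] applies to every
     summand. *)
  have est (j : 'I_(2 ^ m)) r : 0 < r < 1 ->
    `|cot_deriv q ((j%:R + r) / N) - q`!%:R * (pi / N) ^- q.+1 * (j%:R + r) ^- q.+1|
      <= C * (pi / N) ^- q * (j%:R + r) ^- q.
    move=> /andP[r0 r1].
    have := HC ((j%:R + r) / N).
    rewrite -signr_odd (negPf q_even) expr0 !mul1r.
    have -> : pi * ((j%:R + r) / N) = (pi / N) * (j%:R + r) by field; rewrite gt_eqF.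
    have E a b n : (a * b) ^- n = a ^- n * b ^- n :> R by rewrite exprMn invfM.
    rewrite !(E (pi / N)) !mulrA; apply.
    rewrite divr_gt0 //=; last by rewrite ltr_wpDl.
    rewrite ler_pdivrMr // /N exprS mulKf //.
    have := ltn_ord j; rewrite -(ler_nat R) natrX -natr1; lra.
  have -> : pi ^+ q.+1 / q`!%:R * cot_deriv q t - S m =
     (pi / N) ^+ q.+1 / q`!%:R * (\sum_(j < 2 ^ m)
       ((cot_deriv q ((j%:R + t) / N) - q`!%:R * (pi / N) ^- q.+1 * (j%:R + t) ^- q.+1)
      - (cot_deriv q ((j%:R + (1 - t)) / N) - q`!%:R * (pi / N) ^- q.+1 * (j%:R + (1
        - t)) ^- q.+1))).
    rewrite (eq_bigr (fun j : 'I_(2 ^ m) =>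
      (cot_deriv q ((j%:R + t) / N) - cot_deriv q ((j%:R + (1 - t)) / N))
      - q`!%:R * (pi / N) ^- q.+1 * ((j%:R + t) ^- q.+1 - (j%:R + (1 - t)) ^- q.+1)));
      last by move=> j _; ring.
    rewrite sumrB -cot_deriv_iter // -mulr_sumr -/(S m) -/N.
    rewrite mulrBr; congr (_ - _).
      by rewrite [(pi / N) ^+ _]exprMn exprVn; field; rewrite ?expf_neq0 ?gt_eqF.
    rewrite !mulrA divfK ?gt_eqF // divff ?mul1r // expf_neq0 // mulf_neq0 ?invr_eq0
      ?gt_eqF //.
  rewrite normrM ger0_norm; last by rewrite divr_ge0 ?exprn_ge0 ?divr_ge0 // ltW.
  apply: (@le_trans _ _ ((pi / N) ^+ q.+1 / q`!%:R * (C * (pi / N) ^- q * (t ^- q * 2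
    + (1 - t) ^- q * 2)))).
    rewrite ler_wpM2l //; first by rewrite divr_ge0 ?exprn_ge0 ?divr_ge0 // ltW.
    rewrite (le_trans (ler_norm_sum _ _ _)) //.
    apply: (@le_trans _ _ (C * (pi / N) ^- q * (\sum_(j < 2 ^ m) (j%:R + t) ^- q +
      \sum_(j < 2 ^ m) (j%:R + (1 - t)) ^- q))).
      rewrite -big_split mulr_sumr /=; apply: ler_sum => j _.
      rewrite (le_trans (ler_normB _ _)) // mulrDr lerD ?est //; lra.
    have c0 : 0 <= C * (pi / N) ^- q.
      by rewrite mulr_ge0 // invr_ge0 exprn_ge0 // divr_ge0 // ltW.
    rewrite ler_wpM2l // lerD //.
      by apply: sum_inv_exp_le => //; lra.
    by apply: sum_inv_exp_le => //; lra.
  have piN : (pi / N) ^+ q.+1 * (pi / N) ^- q = pi / N.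
    by rewrite exprS mulfK // expf_neq0 // mulf_neq0 ?invr_eq0 ?gt_eqF.
  have -> : (pi / N) ^+ q.+1 / q`!%:R * (C * (pi / N) ^- q * (t ^- q * 2 + (1 - t) ^-
    q * 2)) =
     K / N.
    transitivity ((pi / N) ^+ q.+1 * (pi / N) ^- q * (C * (t ^- q * 2 + (1 - t) ^- q
      * 2) / q`!%:R)).
      by ring.
    by rewrite piN /K; ring.
  have K0 : 0 <= K.
    have h r : 0 < r -> 0 <= (r ^- q : R) by move=> r0; rewrite invr_ge0 exprn_ge0 // ltW.
    have piC0 : 0 <= pi * C by rewrite mulr_ge0 // ltW.
    by rewrite /K divr_ge0 ?(ltW L0) // mulr_ge0 // addr_ge0 // mulr_ge0 // h ?subr_gt0.
  rewrite ler_wpM2l // expr_div_n expr1n div1r lef_pV2 ?posrE ?exprn_gt0 //.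
  by rewrite /N ler_weXn2l // ler1n.
apply/cvgrPdist_le => e e0.
have K0 : (K * (1 / 2) ^+ m @[m --> \oo] --> 0)%classic.
  by apply: cvg_geometric; rewrite ger0_norm; lra.
move/cvgrPdist_le: K0 => /(_ e e0); apply: filterS => m.
rewrite sub0r normrN; apply: le_trans; apply: le_trans (key m) _.
exact: ler_norm.
Qed.

(** * Characters of finite abelian groups and the mean square over the odd ones *)

Lemma trig_mx_mul_diag (F : comNzRingType) (n : nat) (A B : 'M[F]_n) i :
  is_trig_mx A -> is_trig_mx B -> (A *m B) i i = A i i * B i i.
Proof.
move=> /is_trig_mxP tA /is_trig_mxP tB; rewrite mxE (bigD1 i) //= big1 ?addr0 //.
move=> j; rewrite neq_ltn => /orP[lt_ji|lt_ij]; first by rewrite tB ?mulr0.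
by rewrite tA ?mul0r.
Qed.

                                                                    
                     
(** The matrices of the regular representation commute, hence become triangular in one basis. Each
    diagonal entry is then multiplicative in g, and their sum is the trace, that is, the number of
    fixed points of translation by g. *)
Lemma abelian_regular_characters (C : numClosedFieldType) (gT : finGroupType) :
  commutative (@mulg gT) ->
  exists X : 'I_#|gT| -> gT -> C,
    [/\ forall i, X i 1%g = 1,
        forall i, {morph X i : g h / (g * h)%g >-> g * h} &
        forall g, \sum_i X i g = (if g == 1%g then #|gT| else 0%N)%:R].
Proof.
move=> abG; pose n := #|gT|.
pose M g : 'M[C]_n := \matrix_(i, j) (enum_val i * g == enum_val j)%g%:R.
have MM g h : M (g * h)%g = M g *m M h.
  apply/matrixP => i j; rewrite !mxE (bigD1 (enum_rank (enum_val i * g)%g)) //= !mxE.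
  rewrite enum_rankK eqxx mul1r mulgA big1 ?addr0 // => l ne; rewrite !mxE.
  case: eqP => [e|_]; last by rewrite mul0r.
  by case/eqP: ne; rewrite e enum_valK.
have M1 : M 1%g = 1%:M.
  by apply/matrixP => i j; rewrite !mxE mulg1 (inj_eq enum_val_inj).
have comM : {in [seq M g | g <- enum gT] &, forall A B, comm_mx A B}.
  by move=> _ _ /mapP[g _ ->] /mapP[h _ ->]; rewrite /comm_mx -!MM abG.
have [P Pu /allP trigP] := cotrigonalization comM.
have Pu' := unitarymx_unit Pu.
pose T g := conjmx P (M g).
have tT g : is_trig_mx (T g) by apply: (trigP (M g)); apply: map_f; rewrite mem_enum.
have TE g : T g = P *m M g *m invmx P by rewrite /T conjumx.
exists (fun (i : 'I_n) g => T g i i); split.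
- by move=> i; rewrite TE M1 mulmx1 mulmxV // mxE eqxx.
- move=> i g h; rewrite -trig_mx_mul_diag //; congr (fun_of_matrix _ i i).
  by rewrite !TE MM !mulmxA mulmxKV.
move=> g; transitivity (\tr (T g)); first by [].
rewrite TE -mulmxA mxtrace_mulC mulmxKV // /mxtrace.
case: (eqVneq g 1%g) => [->|ne].
  by rewrite M1 (eq_bigr (fun=> 1)) => [|i _]; rewrite ?mxE ?eqxx // sumr_const card_ord.
rewrite big1 // => i _; rewrite mxE -[X in _ == X]mulg1 (inj_eq (mulgI _)).
by rewrite (negPf ne).
Qed.

Lemma character_row_orthogonality (C : numFieldType) (gT : finGroupType)
    (x y : gT -> C) :
  x 1%g = 1 -> {morph x : g h / (g * h)%g >-> g * h} ->
  y 1%g = 1 -> {morph y : g h / (g * h)%g >-> g * h} ->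
  \sum_g x g^-1%g * y g = (if x == y then #|gT| else 0%N)%:R.
Proof.
move=> x1 xM y1 yM; case: eqP => [<-|ne].
  rewrite (eq_bigr (fun=> 1)) ?sumr_const // => g _.
  by rewrite -xM mulVg.
have [g0 ne0] : exists g, x g != y g.
  apply: contrapT => h; apply: ne; apply/funext => g; apply: contrapT => hg.
  by apply: h; exists g; apply/eqP.
have xg0 : x g0 * x g0^-1%g = 1 by rewrite -xM mulgV.
have xg0n : x g0 != 0 by apply: contra_eq_neq xg0 => ->; rewrite mul0r eq_sym oner_eq0.
set S := \sum_g _.
have e : S = x g0^-1%g * y g0 * S.
  rewrite {1}/S (reindex_inj (mulIg g0)) mulr_sumr; apply: eq_bigr => g _.
  by rewrite invMg xM yM; ring.
apply/eqP; have : (1 - x g0^-1%g * y g0) * S = 0 by rewrite mulrBl mul1r -e subrr.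
move/eqP; rewrite mulf_eq0 => /orP[|//].
rewrite subr_eq0 => /eqP/(congr1 (fun z => x g0 * z)).
by rewrite mulr1 mulrA xg0 mul1r => /eqP; rewrite (negPf ne0).
Qed.

Section CompleteCharacters.
Variables (C : numFieldType) (gT : finGroupType) (X : 'I_#|gT| -> gT -> C).
Hypotheses (X1 : forall i, X i 1%g = 1)
  (XM : forall i, {morph X i : g h / (g * h)%g >-> g * h})
  (Xsum : forall g, \sum_i X i g = (if g == 1%g then #|gT| else 0%N)%:R).

(** Evaluate the sum over g of x(g^-1) sum_i X_i(g) twice: the trace formula gives |G|, row
    orthogonality gives |G| times the multiplicity of x in the family. *)
Lemma card_character_eq (x : gT -> C) :
  x 1%g = 1 -> {morph x : g h / (g * h)%g >-> g * h} ->
  #|[pred i | x == X i]| = 1%N.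
Proof.
move=> x1 xM.
have n0 : (#|gT|%:R : C) != 0.
  by rewrite pnatr_eq0 -lt0n; apply/card_gt0P; exists 1%g.
have : \sum_g x g^-1%g * \sum_i X i g = #|gT|%:R.
  rewrite (bigD1 1%g) //= Xsum eqxx invg1 x1 mul1r big1 ?addr0 // => g ne.
  by rewrite Xsum (negPf ne) mulr0.
under eq_bigr do rewrite mulr_sumr.
rewrite exchange_big /= (eq_bigr (fun i => #|gT|%:R * (x == X i)%:R)); last first.
  move=> i _; rewrite character_row_orthogonality //.
  by case: ifP; rewrite ?mulr1 ?mulr0.
rewrite -mulr_sumr -natr_sum => /eqP; rewrite -{2}[_%:R]mulr1.
rewrite (inj_eq (mulfI n0)) pnatr_eq1 => /eqP <-.
by rewrite -sum1_card big_mkcond; apply: eq_bigr => i _; rewrite inE; case: eqP.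
Qed.

Lemma character_inj : injective X.
Proof.
move=> i j e; have := card_character_eq (X i) (X1 i) (XM i).
by move=> /mem_card1[l hl]; have := hl i; have := hl j; rewrite !inE -e eqxx =>
  /esym/eqP-> /esym/eqP.
Qed.

Lemma character_index (x : gT -> C) :
  x 1%g = 1 -> {morph x : g h / (g * h)%g >-> g * h} -> exists i, x = X i.
Proof.
by move=> x1 xM; have /mem_card1[l hl] := card_character_eq x x1 xM; exists l;
   have := hl l; rewrite !inE eqxx => /eqP.
Qed.

End CompleteCharacters.

Section OddCharacters.
Variables (R : realType) (k : nat).
Local Notation C := R[i].
Local Notation G := {unit 'Z_k}.

Definition dirichlet_ext (x : G -> C) : {ffun 'Z_k -> C} :=
  [ffun a => oapp x 0 (insub a)].

Lemma dirichlet_ext_val x (u : G) : dirichlet_ext x (val u) = x u.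
Proof. by rewrite ffunE valK. Qed.

Lemma sum_dirichlet_ext x (F : 'Z_k -> C) :
  \sum_a dirichlet_ext x a * F a = \sum_(u : G) x u * F (val u).
Proof.
rewrite (bigID (fun a : 'Z_k => a \is a GRing.unit)) /= [X in _ + X]big1 ?addr0; last
  first.
  by move=> a nua; rewrite ffunE insubN // mul0r.
rewrite (reindex_omap val (insub : 'Z_k -> option G)) => [|a ua]; last by rewrite insubT.
rewrite (eq_bigl xpredT) => [|u]; last by rewrite valK eqxx (valP u).
by apply: eq_bigr => u _; rewrite dirichlet_ext_val.
Qed.

Lemma dirichlet_extP x : x 1%g = 1 -> {morph x : g h / (g * h)%g >-> g * h} ->
  is_dirichlet_char (dirichlet_ext x).
Proof.
move=> x1 xM; split.
- by have := dirichlet_ext_val x 1%g; rewrite x1.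
- move=> a b; have [ua|nua] := boolP (a \is a GRing.unit); last first.
    by rewrite !ffunE !(@insubN _ _ _ a) // insubN ?mul0r // unitrM (negPf nua).
  have [ub|nub] := boolP (b \is a GRing.unit); last first.
    by rewrite !ffunE !(@insubN _ _ _ b) // insubN ?mulr0 // unitrM (negPf nub) andbF.
  have := dirichlet_ext_val x ((FinRing.unit _ ua) * (FinRing.unit _ ub))%g.
  by rewrite xM -!dirichlet_ext_val.
- by move=> a nua; rewrite ffunE insubN.
Qed.

Lemma dirichlet_char_ext (chi : {ffun 'Z_k -> C}) : is_dirichlet_char chi ->
  chi = dirichlet_ext (fun u => chi (val u)).
Proof.
move=> [chi1 chiM chi0]; apply/ffunP => a; rewrite ffunE.
by case: insubP => [u _ <-|/chi0].
Qed.

(** The weight (1 - chi(-1))/2 selects the odd characters. Expanding the square and summing over all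
    characters leaves the pairs v = u and v = -u only, and averaging over u and -u completes the
    square. *)
Lemma sum_odd_dirichlet_chars (l : 'Z_k -> R) :
  \sum_(chi \in odd_dirichlet_chars R k) `|\sum_a chi a * (l a)%:C| ^+ 2 =
  (#|{: G}|%:R / 4 * \sum_(u : G) (l (val u) - l (- val u)) ^+ 2)%:C.
Proof.
have [|X [X1 XM Xsum]] := abelian_regular_characters C G.
  by move=> g h; apply: val_inj; rewrite /= mulrC.
have Xinj := character_inj _ _ _ X1 XM Xsum.
pose m1 : G := FinRing.unit _ (unitrN1 'Z_k).
have m1m1 : (m1 * m1)%g = 1%g by apply: val_inj; rewrite /= mulrNN mulr1.
have X_neq0 i g : X i g != 0.
  have : X i g * X i g^-1%g = 1 by rewrite -XM mulgV X1.
  by apply: contra_eq_neq => ->; rewrite mul0r eq_sym oner_eq0.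
have Xm1 i : X i m1 = 1 \/ X i m1 = -1.
  have : X i m1 ^+ 2 = 1 by rewrite expr2 -XM m1m1 X1.
  by move/eqP; rewrite sqrf_eq1 => /orP[] /eqP; [left|right].
(* Since g has finite order, X_i(g) has modulus 1, so its conjugate is its inverse. *)
have Xconj i g : (X i g)^* = X i g^-1%g.
  have XX n : X i (g ^+ n)%g = X i g ^+ n.
    by elim: n => [|n IHn]; rewrite ?X1 // expgS exprS XM IHn.
  have nX : `|X i g| = 1.
    have e : `|X i g| ^+ #[g]%g = 1 by rewrite -normrX -XX expg_order X1 normr1.
    by apply/eqP; rewrite -(@pexpr_eq1 _ _ #[g]%g) ?e ?order_gt0.
  apply: (mulfI (X_neq0 i g)); rewrite -normCK nX expr1n -XM mulgV X1 //.
(* By completeness the odd Dirichlet characters are exactly the extensions by zero of the X_i with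
   X_i(-1) = -1, so the sum over a set becomes one over a finite index. *)
have -> : odd_dirichlet_chars R k =
   (fun i => dirichlet_ext (X i)) @` [set` [pred i | X i m1 == - 1]].
  apply/seteqP; split => [chi [chiD chi_odd]|_ [i /= /eqP iodd <-]].
    have [c1 cM _] := chiD.
    have [||i xi] := character_index _ _ _ X1 XM Xsum (fun u => chi (val u)).
    - exact: c1.
    - by move=> g h; rewrite -cM.
    exists i => /=; first by rewrite inE -xi /= chi_odd.
    by rewrite -xi -dirichlet_char_ext.
  by split; [exact: dirichlet_extP|rewrite -(dirichlet_ext_val (X i) m1) in iodd *].
rewrite fsbig_image; last first.
  move=> i j _ _ /= e; apply: Xinj; apply/funext => u.
  by rewrite -(dirichlet_ext_val (X i)) e dirichlet_ext_val.
rewrite -(@bigfs _ _ _ _ (index_enum _)) ?index_enum_uniq //; last by move=> i _;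
  rewrite mem_index_enum.
pose L i := \sum_(u : G) X i u * (l (val u))%:C.
have conjR (r : R) : (r%:C)^* = r%:C.
  by rewrite -[_^*]/(conjc _) /= oppr0.
transitivity (\sum_i (1 - X i m1) / 2 * (L i * (L i)^*)).
  rewrite big_mkcond; apply: eq_bigr => i _ /=.
  rewrite sum_dirichlet_ext normCK -/(L i).
  have [->|->] := Xm1 i; first by rewrite subrr !mul0r -addr_eq0 (pnatr_eq0 _ 2).
  by rewrite eqxx opprK divff ?mul1r // pnatr_eq0.
have LL i : L i * (L i)^* = \sum_u \sum_v X i (u * v^-1)%g * ((l (val u))%:C * (l
  (val v))%:C).
  rewrite {2}/L rmorph_sum /= mulr_suml; apply: eq_bigr => u _.
  rewrite mulr_sumr; apply: eq_bigr => v _.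
  by rewrite rmorphM /= Xconj conjR XM; ring.
under eq_bigr do rewrite LL mulr_sumr.
rewrite exchange_big /=.
have E u : \sum_i (1 - X i m1) / 2 * \sum_v X i (u * v^-1)%g * ((l (val u))%:C * (l
  (val v))%:C)
   = (#|{: G}|%:R / 2 * (l (val u) * (l (val u) - l (- val u))))%:C.
  under eq_bigr do rewrite mulr_sumr.
  rewrite exchange_big /=.
  transitivity (\sum_v ((if v == u then #|{: G}| else 0%N)%:R -
     (if v == (m1 * u)%g then #|{: G}| else 0%N)%:R) / 2 * ((l (val u))%:C * (l (val
       v))%:C)).
    apply: eq_bigr => v _.
    have <- : (u * v^-1 == 1)%g = (v == u) by rewrite -eq_mulgV1 eq_sym.
    have <- : (m1 * (u * v^-1) == 1)%g = (v == m1 * u)%g.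
      by rewrite mulgA -eq_mulgV1 eq_sym.
    rewrite -!Xsum -sumrB !mulr_suml; apply: eq_bigr => i _.
    by rewrite (XM i m1); ring.
  under eq_bigr do rewrite mulrBl mulrBl.
  rewrite sumrB (bigD1 u) //= eqxx [X in _ + X - _]big1 ?addr0; last first.
    by move=> v /negPf ->; rewrite mul0r mul0r.
  rewrite (bigD1 (m1 * u)%g) //= eqxx [X in _ - (_ + X)]big1 ?addr0; last first.
    by move=> v /negPf ->; rewrite mul0r mul0r.
  rewrite mulN1r -(rmorph_nat (@real_complex R)) -(rmorph_nat (@real_complex R) 2).
  by rewrite -fmorphV -!rmorphM -rmorphB /=; congr (_%:C); ring.
under eq_bigr do rewrite E.
rewrite -rmorph_sum -mulr_sumr; congr (_%:C).
set S := \sum_u _.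
have S2 : S = \sum_(u : G) (l (- val u) * (l (- val u) - l (val u))).
  rewrite /S (reindex_inj (mulgI m1)); apply: eq_bigr => u _.
  by rewrite /= mulN1r opprK.
have -> : \sum_(u : G) (l (val u) - l (- val u)) ^+ 2 = S + S.
  by rewrite {2}S2 -big_split /=; apply: eq_bigr => u _; ring.
by field.
Qed.

End OddCharacters.

(** * L-values as sums over residue classes *)

Lemma natcpow_opp_natr (R : realType) (n s : nat) :
  natcpow n (- s%:R : R[i]) = (n%:R ^- s)%:C.
Proof.
have -> : (- s%:R : R[i]) = (- s%:R)%:C by rewrite rmorphN rmorph_nat.
by rewrite /natcpow /= mul0r cos0 sin0 powR_invn // mulr1.
Qed.

Lemma cvg_real_complex (R : realType) (u : nat -> R) (l : R) :
  (u n @[n --> \oo] --> l)%classic ->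
  ((u n)%:C : R[i]^o) @[n --> \oo] --> (l%:C : R[i]^o).
Proof.
move=> ul; apply/cvgrPdist_lt => e; rewrite ltcE => /andP[/eqP ie re].
have -> : e = (complex.Re e)%:C by case: e ie {re} => a b /= ->.
move/cvgrPdist_lt: ul => /(_ _ re); apply: filterS => n.
by rewrite -rmorphB normc_def /= expr0n addr0 sqrtr_sqr ltcR.
Qed.

Section ResidueClassSums.
Variables (R : realType) (k s : nat).

Definition residue_series (a : 'Z_k) (n : nat) : R :=
  \sum_(i < n | i.+1%:R == a) i.+1%:R ^- s.

(** For k > 1, s >= 2 and a the class of m with 0 < m <= k, this is k^-s times the Hurwitz zeta
    value at (s, m/k). *)
Definition residue_sum (a : 'Z_k) : R := limn (residue_series a).

(** Each block of k consecutive integers meets the class exactly once, at offset m - 1 because the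
    index i stands for the integer i + 1. *)
Lemma residue_series_period (a : 'Z_k) (m M : nat) : (1 < k)%N ->
  (0 < m <= k)%N -> a = m%:R ->
  residue_series a (M * k) = \sum_(j < M) (j * k + m)%:R ^- s.
Proof.
move=> k1 /andP[m0 mk] ->; rewrite /residue_series -(big_mkord (fun i => i.+1%:R ==
  m%:R :> 'Z_k) (fun i => i.+1%:R ^- s)).
elim: M => [|M IHM]; first by rewrite mul0n big_nil big_ord0.
rewrite big_ord_recr /= -IHM mulSn addnC.
rewrite (big_cat_nat (leq0n _) (leq_addr _ _)) /=; congr (_ + _).
rewrite -{1}[(M * k)%N]add0n big_addn addKn.
have lt_m : (m.-1 < k)%N by lia.
rewrite big_mkord (big_pred1 (Ordinal lt_m)) /=.
  by rewrite -addSn prednK // addnC.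
move=> r /=; rewrite -addSn natrD natrM.
have k0 : (k%:R : 'Z_k) = 0 by rewrite -(Zp_nat_mod k1) modnn.
rewrite k0 mulr0 addr0 -[RHS]/(nat_of_ord r == m.-1).
apply/eqP/eqP => [/(congr1 val)|->]; last by rewrite prednK.
rewrite /= !val_Zp_nat //; have := ltn_ord r.
rewrite leq_eqVlt => /orP[/eqP rk|rk].
  rewrite rk modnn; move: mk; rewrite leq_eqVlt => /orP[/eqP|lt_mk]; first by lia.
  by rewrite modn_small //; lia.
rewrite (modn_small rk); move: mk; rewrite leq_eqVlt => /orP[/eqP->|lt_mk].
  by rewrite modnn.
by rewrite modn_small // => <-.
Qed.

Hypothesis s_ge2 : (2 <= s)%N.

Lemma cvg_residue_series a :
  (residue_series a n @[n --> \oo] --> residue_sum a)%classic.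
Proof.
apply: nondecreasing_is_cvgn.
  apply/nondecreasing_seqP => n; rewrite /residue_series big_mkcond [leRHS]big_mkcond.
  rewrite big_ord_recr /= lerDl.
  by case: ifP => // _; rewrite invr_ge0 exprn_ge0.
exists 2 => _ [n _ <-].
apply: le_trans (sum_inv_sqr_le R n); rewrite /residue_series big_mkcond /=.
apply: ler_sum => i _.
have i0 : (0 : R) < i.+1%:R by rewrite ltr0n.
case: ifP => _; last by rewrite invr_ge0 exprn_ge0 // ltW.
by rewrite lef_pV2 ?posrE ?exprn_gt0 // ler_weXn2l // ler1n.
Qed.

Lemma dirichlet_L_residue_sum (chi : {ffun 'Z_k -> R[i]}) :
  dirichlet_L s%:R chi = \sum_a chi a * (residue_sum a)%:C.
Proof.
pose f (n : nat) : R[i]^o := \sum_a chi a *: ((residue_series a n)%:C : R[i]^o).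
have fl : f n @[n --> \oo] --> (\sum_a chi a *: ((residue_sum a)%:C : R[i]^o)).
  apply: cvg_big => [|a _]; first exact: add_continuous.
  exact: cvgZl_tmp (cvg_real_complex _ _ _ (cvg_residue_series a)).
suff E : series (fun i : nat => chi i.+1%:R * natcpow i.+1 (- s%:R) : (R[i])^o) = f.
  by rewrite /dirichlet_L E; exact: (cvg_lim (@norm_hausdorff _ R[i]^o) fl).
apply/funext => n; rewrite /series /= big_mkord.
rewrite (eq_bigr (fun i : 'I_n => \sum_a if i.+1%:R == a then chi a * (i.+1%:R ^-
  s)%:C else 0)); last first.
  move=> i _; rewrite natcpow_opp_natr (bigD1 i.+1%:R) //= eqxx big1 ?addr0 //.
  by move=> a; rewrite eq_sym => /negPf ->.
rewrite exchange_big; apply: eq_bigr => a _.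
by rewrite /residue_series rmorph_sum /= scaler_sumr -big_mkcond.
Qed.

End ResidueClassSums.

(** The class of -m is that of k - m, so with t = m/k the two series pair into k^-(q+1) times the
    partial fraction series at t. *)
Lemma residue_sum_sub (R : realType) (k q m : nat) : (1 < k)%N ->
  ~~ odd q -> (2 <= q)%N -> (0 < m < k)%N ->
  residue_sum R k q.+1 m%:R - residue_sum R k q.+1 (- m%:R) =
  (pi / k%:R) ^+ q.+1 / q`!%:R * cot_deriv q (m%:R / k%:R).
Proof.
move=> k1 q_even q2 /andP[m0 mk].
have kR : (0 : R) < k%:R by rewrite ltr0n ltnW.
have q3 : (2 <= q.+1)%N by rewrite ltnW.
pose t : R := m%:R / k%:R.
have mR : (0 : R) < m%:R by rewrite ltr0n.
have mkR : (m%:R : R) < k%:R by rewrite ltr_nat.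
have tI : 0 < t < 1 by apply/andP; rewrite /t divr_gt0 // ltr_pdivrMr // mul1r.
(* Both residue series converge, so their limits may be read along the truncations 2^n k, for which
   the partial fractions are known. *)
have subseq : ((2 ^ n * k)%N @[n --> \oo] --> \oo)%classic.
  apply/cvgnyPge => A; exists A => // n /= An.
  by rewrite (leq_trans An) // (leq_trans (ltnW (ltn_expl n (ltnSn 1)))) // leq_pmulr
    // ltnW.
have c1 := cvg_comp _ _ subseq (cvg_residue_series R k q.+1 q3 m%:R).
have c2 := cvg_comp _ _ subseq (cvg_residue_series R k q.+1 q3 (- m%:R)).
have c3 := cvgZl_tmp (k := k%:R ^- q.+1) (cot_deriv_partial_fractions R q t q_even q2
  tI) _.
have := cvgB c1 c2.
have -> : (residue_series R k q.+1 m%:R \o (fun n => (2 ^ n * k)%N)) -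
  (residue_series R k q.+1 (- m%:R) \o (fun n => (2 ^ n * k)%N)) =
  (fun n => k%:R ^- q.+1 *: \sum_(j < 2 ^ n) ((j%:R + t) ^- q.+1 - (j%:R + (1 - t))
    ^- q.+1)).
  apply/funext => n.
  rewrite -[LHS]/(residue_series R k q.+1 m%:R (2 ^ n * k) -
    residue_series R k q.+1 (- m%:R) (2 ^ n * k)).
  rewrite (residue_series_period R k q.+1 m%:R m) ?m0 ?(ltnW mk) //.
  rewrite (residue_series_period R k q.+1 (- m%:R) (k - m)) //; first last.
  - rewrite natrB ?(ltnW mk) // -(Zp_nat_mod k1 k) modnn.
    by rewrite sub0r.
  - by rewrite subn_gt0 mk leq_subr.
  rewrite -sumrB scaler_sumr; apply: eq_bigr => j _.
  rewrite -[RHS]/(_ * _) mulrBr -!invfM -!exprMn.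
  congr ((_ ^+ _)^-1 - (_ ^+ _)^-1).
    by rewrite natrD natrM /t; field; lra.
  by rewrite natrD natrM natrB ?(ltnW mk) // /t; field; lra.
have FF : Filter \oo by exact: eventually_filter.
move=> c4; rewrite (cvg_unique _ (c4 FF) (c3 FF)); last exact: norm_hausdorff.
rewrite -[LHS]/(_ * _) -/t expr_div_n; ring.
Qed.

Lemma sum_units_Zp (R : realType) (k : nat) (F : nat -> R) : (1 < k)%N ->
  \sum_(u : {unit 'Z_k}) F (nat_of_ord (val u)) =
  \sum_(1 <= m < k.+1 | coprime m k) F m.
Proof.
move=> k1.
transitivity (\sum_(a : 'Z_k | a \is a GRing.unit) F a).
  rewrite (reindex_omap val (insub : 'Z_k -> option {unit 'Z_k})) => [|a ua]; last by
    rewrite insubT.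
  by apply: eq_bigl => u; rewrite valK eqxx (valP u).
transitivity (\sum_(0 <= m < k | coprime m k) F m).
  transitivity (\sum_(0 <= m < (Zp_trunc k).+2 | coprime m k) F m); last by rewrite
    Zp_cast.
  rewrite big_mkord; apply: eq_bigl => a.
  by rewrite coprime_sym -(unitZpE _ k1) natr_Zp.
(* The ranges 0..k-1 and 1..k differ only by 0 and k, neither coprime to k since k > 1. *)
rewrite [LHS]big_mkcond big_ltn ?(ltnW k1) // [RHS]big_mkcond [RHS]big_nat_recr
  ?(ltnW k1) //=.
rewrite /coprime gcdnn gcd0n (gtn_eqF k1) add0r addr0.
by [].
Qed.

                                                                             
(** * Multiple angles and the powers of 1/(e^(2ix) - 1) *)

(** The Chebyshev polynomial of the second kind U_n at z/2. Terms with 2e > n vanish through the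
    binomial, so truncated subtraction does no harm. *)
Definition cheb_U (F : comNzRingType) (n : nat) (z : F) : F :=
  \sum_(0 <= e < n.+1) (-1) ^+ e * 'C(n - e, e)%:R * z ^+ (n - 2 * e).

Lemma cheb_U_wide (F : comNzRingType) n N (z : F) : (n < N)%N ->
  cheb_U F n z = \sum_(0 <= e < N) (-1) ^+ e * 'C(n - e, e)%:R * z ^+ (n - 2 * e).
Proof.
move=> nN; rewrite [RHS](big_cat_nat (leq0n n.+1) nN) /= -[LHS]addr0; congr (_ + _).
rewrite big_nat_cond big1 // => e; rewrite andbT => /andP[ne _].
by rewrite bin_small ?mulr0 ?mul0r //; lia.
Qed.

Lemma cheb_US (F : comNzRingType) n (z : F) :
  cheb_U F n.+2 z = z * cheb_U F n.+1 z - cheb_U F n z.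
Proof.
rewrite {1}/cheb_U (cheb_U_wide F n.+1 n.+3) // (cheb_U_wide F n n.+2) //.
rewrite big_nat_recl // [in RHS]big_nat_recl // mulrDr mulr_sumr -addrA -sumrB.
congr (_ + _); first by rewrite muln0 !subn0 !bin0 exprS; ring.
apply: eq_big_nat => e /andP[_ en].
have [e_le|e_gt] := leqP e n; last first.
  by rewrite !bin_small; [ring|lia..].
have -> : (n.+2 - e.+1 = (n - e).+1)%N by lia.
have -> : (n.+1 - e.+1 = n - e)%N by lia.
have -> : (n.+2 - 2 * e.+1 = n - 2 * e)%N by lia.
rewrite binS natrD exprS.
have [le_n|lt_n] := leqP (2 * e).+1 n; last first.
  by rewrite (@bin_small (n - e) e.+1); [ring|lia].
have -> : (n - 2 * e = (n.+1 - 2 * e.+1).+1)%N by lia.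
by rewrite exprS; ring.
Qed.

Lemma sin_natmul (R : realType) n (x : R) :
  sin (n.+1%:R * x) = sin x * cheb_U R n (2 * cos x).
Proof.
suff [] : sin (n.+1%:R * x) = sin x * cheb_U R n (2 * cos x) /\
    sin (n.+2%:R * x) = sin x * cheb_U R n.+1 (2 * cos x) by [].
elim: n => [|n [IH1 IH2]].
  rewrite /cheb_U !big_nat_recr //= big_geq // mul1r !bin0 subn0 muln0 mul1r expr0.
  rewrite (mulr_natl x 2) sin_mulr2n /= bin0n /=; split; first by ring.
  by rewrite big_geq // subn0; ring.
split=> //; rewrite cheb_US mulrBr mulrCA -IH1 -IH2.
have -> : n.+3%:R * x = n.+2%:R * x + x by rewrite -[n.+3%:R]natr1 mulrDl mul1r.
have -> : n.+1%:R * x = n.+2%:R * x - x.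
  by rewrite -[n.+2%:R]natr1 mulrDl mul1r addrK.
rewrite sinD sinB; ring.
Qed.

Lemma half_bound n e : (e < (n %/ 2).+1)%N = (2 * e <= n)%N.
Proof. by rewrite ltnS leq_divRL // mulnC. Qed.

Lemma cheb_U_half (F : comNzRingType) n (z : F) :
  cheb_U F n z =
  \sum_(0 <= e < (n %/ 2).+1) (-1) ^+ e * 'C(n - e, e)%:R * z ^+ (n - 2 * e).
Proof.
have nN : ((n %/ 2).+1 <= n.+1)%N by rewrite ltnS leq_div.
rewrite /cheb_U (big_cat_nat (leq0n _) nN) /= [X in _ + X]big_nat_cond.
rewrite [X in _ + X]big1 ?addr0 // => e; rewrite andbT => /andP[+ _].
rewrite leqNgt half_bound -ltnNge => ne.
by rewrite bin_small ?mulr0 ?mul0r //; lia.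
Qed.

Lemma bin_lucas (n e : nat) : (2 * e <= n.+2)%N ->
  (('C(n.+2 - e, e) + (if e is e'.+1 then 'C(n - e', e') else 0)) *
     (e`! * (n.+2 - 2 * e)`!) = n.+2 * (n.+2 - e - 1)`!)%N.
Proof.
case: e => [|e] le_en.
  by rewrite bin0 fact0 mul1n addn0 mul1n muln0 !subn0 subn1.
have e1 : ('C(n.+2 - e.+1, e.+1) * (e.+1`! * (n.+2 - 2 * e.+1)`!) = (n.+2 - e.+1)`!)%N.
  have -> : (n.+2 - 2 * e.+1 = n.+2 - e.+1 - e.+1)%N by lia.
  by apply: bin_fact; lia.
have e2 : ('C(n - e, e) * (e`! * (n.+2 - 2 * e.+1)`!) = (n - e)`!)%N.
  have -> : (n.+2 - 2 * e.+1 = n - e - e)%N by lia.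
  by apply: bin_fact; lia.
rewrite mulnDl e1 factS -mulnA mulnCA e2.
have -> : (n.+2 - e.+1 = (n - e).+1)%N by lia.
rewrite factS subn1 /= -mulnDl; congr (_ * _)%N; lia.
Qed.

(** From 2 sin x cos(Nx) = sin((N+1)x) - sin((N-1)x), the left side is U_N - U_{N-2} at cos x with N
    = n + 2. Its coefficients are given by [bin_lucas]. *)
Lemma cos_natmul (R : realType) n (x : R) : sin x != 0 ->
  2 * cos (n.+2%:R * x) =
  \sum_(0 <= e < (n.+2 %/ 2).+1) (-1) ^+ e *
    ((n.+2 * (n.+2 - e - 1)`!)%:R / (e`! * (n.+2 - 2 * e)`!)%:R) *
    (2 * cos x) ^+ (n.+2 - 2 * e).
Proof.
move=> s0; set z := 2 * cos x.
have -> : 2 * cos (n.+2%:R * x) = cheb_U R n.+2 z - cheb_U R n z.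
  apply: (mulfI s0); rewrite mulrBr -!sin_natmul.
  have -> : n.+3%:R * x = n.+2%:R * x + x by rewrite -[n.+3%:R]natr1 mulrDl mul1r.
  have -> : n.+1%:R * x = n.+2%:R * x - x.
    by rewrite -[n.+2%:R]natr1 mulrDl mul1r addrK.
  by rewrite sinD sinB; ring.
rewrite !cheb_U_half.
have -> : (n.+2 %/ 2 = (n %/ 2).+1)%N by rewrite -[n.+2]addn2 divnDr // addn1.
rewrite [in LHS]big_nat_recl // [RHS]big_nat_recl // -addrA -sumrB.
have F0 e : ((e`! * (n.+2 - 2 * e)`!)%:R : R) != 0.
  by rewrite pnatr_eq0 -lt0n muln_gt0 !fact_gt0.
congr (_ + _).
  have := @bin_lucas n 0 (leq0n _) => /(congr1 (fun m => m%:R : R)).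
  by rewrite natrM addn0 => <-; rewrite mulfK.
apply: eq_big_nat => e /andP[_]; rewrite half_bound => en.
have := @bin_lucas n e.+1 ltac:(lia) => /(congr1 (fun m => m%:R : R)).
rewrite natrM natrD => <-; rewrite mulfK //.
have -> : (n.+2 - 2 * e.+1 = n - 2 * e)%N by lia.
by rewrite exprS; ring.
Qed.

                             
(** When sin x is nonzero this is 1/(e^(2ix) - 1) = -i e^(-ix) / (2 sin x), so its powers are read
    off from cos nx and sin nx. *)
Definition cot_root {R : realType} (x : R) : R[i] := - 2^-1 -i* (cot x / 2).

Section CotRootPowers.
Variables (R : realType) (x : R).
Hypothesis sinx : sin x != 0.

Lemma cot_rootX_double p : cot_root x ^+ (2 * p) =
  ((-1) ^+ p / (2 * sin x) ^+ (2 * p))%:C *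
  (cos ((2 * p)%:R * x) -i* sin ((2 * p)%:R * x)).
Proof.
elim: p => [|p IHp].
  by rewrite muln0 !expr0 invr1 !mul1r mul0r cos0 sin0 oppr0.
have -> : (2 * p.+1 = 2 * p + 2)%N by lia.
have -> : (2 * p + 2)%:R * x = (2 * p)%:R * x + x *+ 2.
  by rewrite natrD mulrDl (mulr_natl x 2).
rewrite exprD IHp.
have -> : cot_root x ^+ 2 =
    (- ((2 * sin x) ^+ 2)^-1)%:C * (cos (x *+ 2) -i* sin (x *+ 2)).
  rewrite cos_mulr2n sin_mulr2n cos2sin2 /cot_root /cot expr2.
  have c2 := cos2sin2 x; move: (sin x) (cos x) sinx c2 => S c S0 c2.
  apply/eqP; rewrite eq_complex /=; apply/andP; split; apply/eqP.
    transitivity (4^-1 - c ^+ 2 / S ^+ 2 / 4); first by field.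
    by rewrite c2; field.
  by field.
rewrite mulrACA -rmorphM; congr (_%:C * _).
  by rewrite [(-1) ^+ p.+1]exprS exprD (invfM ((2 * sin x) ^+ (2 * p))); ring.
rewrite (cosD ((2 * p)%:R * x)) (sinD ((2 * p)%:R * x)).
by apply/eqP; rewrite eq_complex /=; apply/andP; split; apply/eqP; ring.
Qed.

Lemma Re_cot_rootX_even p : complex.Re (cot_root x ^+ (2 * p)) =
  (-1) ^+ p / (2 * sin x) ^+ (2 * p) * cos ((2 * p)%:R * x).
Proof. by rewrite cot_rootX_double /= mul0r subr0. Qed.

Lemma Re_cot_rootX_odd p : complex.Re (cot_root x ^+ (2 * p).+1) =
  (-1) ^+ p.+1 / (2 * sin x) ^+ (2 * p).+1 * sin ((2 * p).+1%:R * x).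
Proof.
have -> : (2 * p).+1%:R * x = (2 * p)%:R * x + x.
  by rewrite -[(2 * p).+1%:R]natr1 mulrDl mul1r.
rewrite (exprSr (cot_root x)) cot_rootX_double /cot_root /= sinD /cot.
rewrite [(-1) ^+ p.+1]exprS (exprSr (2 * sin x)); set r := _ ^+ p; set t := _ ^+ (2 * p).
have t0 : t != 0 by rewrite expf_neq0 // mulf_neq0 // pnatr_eq0.
by field; rewrite t0 sinx.
Qed.

Lemma cos_expn_sum (n q : nat) : (2 * q <= n)%N ->
  cos x ^+ (2 * q) / sin x ^+ n =
  \sum_(0 <= d < q.+1) (-1) ^+ d * 'C(q, d)%:R * (sin x ^+ (n - 2 * d))^-1.
Proof.
move=> qn; rewrite exprM cos2sin2 exprDn mulr_suml big_mkord; apply: eq_bigr => d _.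
have dn : (2 * d <= n)%N by have := ltn_ord d; lia.
rewrite expr1n mul1r (exprNn (sin x ^+ 2)) -exprM -mulr_natr -{1}(subnK dn) exprD.
have t0 : sin x ^+ (2 * d) != 0 by rewrite expf_neq0.
have t1 : sin x ^+ (n - 2 * d) != 0 by rewrite expf_neq0.
by field; rewrite t0 t1.
Qed.

(** Expand cos nx in powers of 2 cos x; as n is even these are even powers, which become powers of 1
    - sin^2 x. The factor 2^(n-2c) against 2^n, with the 1/2 of [cos_natmul], leaves 2^-(2c+1). *)
Lemma Re_cot_root_even (n : nat) (A : R) : (0 < n)%N -> ~~ odd n ->
  \sum_(0 <= c < (n %/ 2).+1) \sum_(0 <= d < ((n - 2 * c) %/ 2).+1)
    (-1) ^+ (c + d + n %/ 2) * A
    * ((n * (n - c - 1)`!)%:R / (2 ^ (2 * c + 1) * c`! * (n - 2 * c)`!)%:R)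
    * 'C((n - 2 * c) %/ 2, d)%:R * (sin x ^+ (n - 2 * d))^-1
  = A * complex.Re (cot_root x ^+ n).
Proof.
move=> n0 n_even.
have nE : (2 * (n %/ 2) = n)%N by rewrite mulnC divnK // dvdn2.
have -> : complex.Re (cot_root x ^+ n) =
    (-1) ^+ (n %/ 2) / (2 * sin x) ^+ n * cos (n%:R * x).
  by rewrite -{1}nE Re_cot_rootX_even nE.
have -> : cos (n%:R * x) = 2^-1 * (2 * cos (n%:R * x)) by rewrite mulKf // pnatr_eq0.
have -> : n = n.-2.+2 by case: n n0 n_even {nE} => [|[|]].
rewrite cos_natmul //.
have -> : n.-2.+2 = n by case: n n0 n_even {nE} => [|[|]].
rewrite !mulr_sumr; apply: eq_big_nat => c /andP[_]; rewrite half_bound => cn.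
set q := ((n - 2 * c) %/ 2)%N.
have qE : (n - 2 * c = 2 * q)%N.
  by rewrite /q [RHS]mulnC divnK // dvdn2 oddB // oddM /= (negPf n_even).
have qn : (2 * q <= n)%N by lia.
rewrite qE !exprMn.
transitivity ((-1) ^+ (c + n %/ 2) * A * ((n * (n - c - 1)`!)%:R / (2 ^ (2 * c + 1) *
  c`! * (2 * q)`!)%:R)
    * (cos x ^+ (2 * q) / sin x ^+ n)).
  rewrite cos_expn_sum // mulr_sumr; apply: eq_big_nat => d _.
  by rewrite addnAC exprD; ring.
rewrite exprD !natrM natrX exprD expr1.
have -> : (2 : R) ^+ n = 2 ^+ (2 * q) * 2 ^+ (2 * c) by rewrite -exprD; congr (_ ^+
  _); lia.
have f0 j : (j`!%:R : R) != 0 by rewrite pnatr_eq0 -lt0n fact_gt0.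
have s0 : sin x ^+ n != 0 by rewrite expf_neq0.
have p0 j : (2 : R) ^+ j != 0 by rewrite expf_neq0 // pnatr_eq0.
by field; rewrite !f0 s0 !p0.
Qed.

(** Here sin nx = sin x U_{n-1}(cos x); the factor sin x cancels one power of the denominator, which
    is why the exponents are n - 2f - 1. *)
Lemma Re_cot_root_odd (n : nat) (A : R) : odd n ->
  \sum_(0 <= e < ((n - 1) %/ 2).+1) \sum_(0 <= f < ((n - 2 * e - 1) %/ 2).+1)
    (-1) ^+ (e + f + (n + 1) %/ 2) * A
    * ((n - e - 1)`!%:R / (2 ^ (2 * e + 1) * e`! * (n - 2 * e - 1)`!)%:R)
    * 'C((n - 2 * e - 1) %/ 2, f)%:R * (sin x ^+ (n - 2 * f - 1))^-1
  = A * complex.Re (cot_root x ^+ n).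
Proof.
case: n => // n /= n_even.
have nE : (2 * (n %/ 2) = n)%N by rewrite mulnC divnK // dvdn2.
have -> : complex.Re (cot_root x ^+ n.+1) =
    (-1) ^+ (n %/ 2).+1 / (2 * sin x) ^+ n.+1 * sin (n.+1%:R * x).
  by rewrite -{1}nE Re_cot_rootX_odd nE.
rewrite subn1 /= sin_natmul cheb_U_half.
have -> : ((n.+1 + 1) %/ 2 = (n %/ 2).+1)%N by rewrite addn1 -addn2 divnDr // addn1.
rewrite !mulr_sumr; apply: eq_big_nat => e /andP[_]; rewrite half_bound => en.
have -> : (n.+1 - 2 * e - 1 = n - 2 * e)%N by lia.
have -> : (n.+1 - e - 1 = n - e)%N by lia.
set q := ((n - 2 * e) %/ 2)%N.
have qE : (n - 2 * e = 2 * q)%N.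
  by rewrite /q [RHS]mulnC divnK // dvdn2 oddB // oddM /= (negPf n_even).
have qn : (2 * q <= n)%N by lia.
have f0 j : (j`!%:R : R) != 0 by rewrite pnatr_eq0 -lt0n fact_gt0.
have binE : 'C(n - e, e)%:R = (n - e)`!%:R / (e`!%:R * (2 * q)`!%:R) :> R.
  rewrite -(@bin_fact (n - e) e); last by lia.
  rewrite (_ : n - e - e = 2 * q)%N ?natrM; last by lia.
  by field; rewrite !f0.
rewrite qE !exprMn binE.
transitivity ((-1) ^+ (e + (n %/ 2).+1) * A * ((n - e)`!%:R / (2 ^ (2 * e + 1) * e`!
  * (2 * q)`!)%:R)
    * (cos x ^+ (2 * q) / sin x ^+ n)).
  rewrite cos_expn_sum // mulr_sumr; apply: eq_big_nat => f _.
  rewrite (_ : n.+1 - 2 * f - 1 = n - 2 * f)%N; last by lia.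
  by rewrite addnAC exprD; ring.
rewrite exprD !natrM natrX exprD expr1 [2 ^+ n.+1]exprS [sin x ^+ n.+1]exprS.
have -> : (2 : R) ^+ n = 2 ^+ (2 * q) * 2 ^+ (2 * e) by rewrite -exprD; congr (_ ^+
  _); lia.
have s0 : sin x ^+ n != 0 by rewrite expf_neq0.
have p0 j : (2 : R) ^+ j != 0 by rewrite expf_neq0 // pnatr_eq0.
by field; rewrite !f0 s0 sinx !p0.
Qed.

End CotRootPowers.

Lemma sin_pi_frac_neq0 (R : realType) (k m : nat) : (1 < k)%N -> (1 <= m < k.+1)%N ->
  coprime m k -> sin (pi * m%:R / k%:R : R) != 0.
Proof.
move=> k1 /andP[m0 mk] cop.
have lt_mk : (m < k)%N.
  rewrite ltn_neqAle -ltnS mk andbT; apply: contraTneq cop => ->.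
  by rewrite /coprime gcdnn gtn_eqF.
have kR : (0 : R) < k%:R by rewrite ltr0n ltnW.
have mR : (0 : R) < m%:R by rewrite ltr0n.
have pi0 := pi_gt0 R.
apply/lt0r_neq0/sin_gt0_pi/andP; split; first by rewrite divr_gt0 // mulr_gt0.
by rewrite ltr_pdivrMr // ltr_pM2l // ltr_nat.
Qed.

(** * Evaluation of [Sigma2] *)

Section SigmaTwo.
Variables (R : realType) (k : nat).
Hypothesis k_gt1 : (1 < k)%N.

Let w (m : nat) : R[i] := cot_root (pi * m%:R / k%:R).

Let E (n : nat) : R := \sum_(1 <= m < k.+1 | coprime m k) complex.Re (w m ^+ n).

Lemma SIN_even (n : nat) (A : R) : (0 < n)%N -> ~~ odd n ->
  \sum_(0 <= c < (n %/ 2).+1) \sum_(0 <= d < ((n - 2 * c) %/ 2).+1)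
    (-1) ^+ (c + d + n %/ 2) * A
    * ((n * (n - c - 1)`!)%:R / (2 ^ (2 * c + 1) * c`! * (n - 2 * c)`!)%:R)
    * 'C((n - 2 * c) %/ 2, d)%:R * SIN R k (n - 2 * d)
  = A * E n.
Proof.
move=> n0 n_even; rewrite /E mulr_sumr /SIN.
rewrite big_nat_cond [RHS]big_nat_cond.
rewrite [RHS](eq_bigr _ (fun m H => esym (Re_cot_root_even R _
  (sin_pi_frac_neq0 R k m k_gt1 (andP H).1 (andP H).2) n A n0 n_even))).
rewrite [RHS]exchange_big /= -big_nat_cond; apply: eq_bigr => c _.
rewrite [RHS]exchange_big /=; apply: eq_bigr => d _.
by rewrite -mulr_sumr -big_nat_cond.
Qed.

Lemma SIN_odd (n : nat) (A : R) : odd n ->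
  \sum_(0 <= e < ((n - 1) %/ 2).+1) \sum_(0 <= f < ((n - 2 * e - 1) %/ 2).+1)
    (-1) ^+ (e + f + (n + 1) %/ 2) * A
    * ((n - e - 1)`!%:R / (2 ^ (2 * e + 1) * e`! * (n - 2 * e - 1)`!)%:R)
    * 'C((n - 2 * e - 1) %/ 2, f)%:R * SIN R k (n - 2 * f - 1)
  = A * E n.
Proof.
move=> n_odd; rewrite /E mulr_sumr /SIN.
rewrite big_nat_cond [RHS]big_nat_cond.
rewrite [RHS](eq_bigr _ (fun m H => esym (Re_cot_root_odd R _
  (sin_pi_frac_neq0 R k m k_gt1 (andP H).1 (andP H).2) n A n_odd))).
rewrite [RHS]exchange_big /= -big_nat_cond; apply: eq_bigr => c _.
rewrite [RHS]exchange_big /=; apply: eq_bigr => d _.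
by rewrite -mulr_sumr -big_nat_cond.
Qed.

(** The summand of [Sigma2] splits into two such factors, one in (q1, j, alpha) and one in (q2, s,
    beta). *)
Let D (h q j a : nat) : R :=
  ratr (bernoulli q) * 'C(2 * h + 1, q)%:R * 'C(2 * h + 1 - q, j)%:R
  * k%:R ^- (2 * h + 1 - q - j) * (A_coef (2 * h + 1 - q - j) a)%:~R.

Let G (h m : nat) : R[i] :=
  \sum_(0 <= q < (2 * h).+1) \sum_(1 <= j < (2 * h + 1 - q).+1)
  \sum_(1 <= a < (2 * h + 2 - q - j).+1) (D h q j a)%:C * w m ^+ a.

Lemma ReM_real (x : R) (z : R[i]) : complex.Re (x%:C * z) = x * complex.Re z.
Proof. by case: z => a b /=; rewrite mul0r subr0. Qed.

Lemma Re_sum (I : Type) (r : seq I) (P : pred I) (F : I -> R[i]) :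
  complex.Re (\sum_(i <- r | P i) F i) = \sum_(i <- r | P i) complex.Re (F i).
Proof. by apply: (big_morph (@complex.Re R)) => // -[a b] [c d]. Qed.

(** The bracket depends on alpha and beta only through the A-number and Re w^(alpha+beta) summed
    over m, so the sixfold sum is the expansion of a square. It is the square of G, not of its
    modulus. *)
Lemma Sigma2_Re_sqr h :
  Sigma2 R k h = \sum_(1 <= m < k.+1 | coprime m k) complex.Re (G h m * G h m).
Proof.
have ReGG m : complex.Re (G h m * G h m) =
  \sum_(0 <= q1 < (2 * h).+1) \sum_(0 <= q2 < (2 * h).+1)
  \sum_(1 <= j < (2 * h + 1 - q1).+1) \sum_(1 <= s < (2 * h + 1 - q2).+1)
  \sum_(1 <= a < (2 * h + 2 - q1 - j).+1) \sum_(1 <= b < (2 * h + 2 - q2 - s).+1)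
    D h q1 j a * D h q2 s b * complex.Re (w m ^+ (a + b)).
  rewrite /G big_distrlr /= Re_sum; apply: eq_bigr => q1 _.
  rewrite Re_sum; apply: eq_bigr => q2 _.
  rewrite big_distrlr /= Re_sum; apply: eq_bigr => j _.
  rewrite Re_sum; apply: eq_bigr => s _.
  rewrite big_distrlr /= Re_sum; apply: eq_bigr => a _.
  rewrite Re_sum; apply: eq_bigr => b _.
  by rewrite mulrACA -rmorphM -exprD ReM_real.
under [RHS]eq_bigr do rewrite ReGG.
rewrite /Sigma2 [RHS]exchange_big /=; apply: eq_bigr => q1 _.
rewrite [RHS]exchange_big /=; apply: eq_bigr => q2 _.
rewrite [RHS]exchange_big /=; apply: eq_big_nat => j /andP[j1 jq].
rewrite [RHS]exchange_big /=; apply: eq_big_nat => s /andP[s1 sq].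
rewrite [RHS]exchange_big /=; apply: eq_big_nat => a /andP[a1 aq].
rewrite [RHS]exchange_big /=.
transitivity (\sum_(1 <= b < (2 * h + 2 - q2 - s).+1) D h q1 j a * D h q2 s b * E (a
  + b)); last first.
  by apply: eq_bigr => b _; rewrite /E mulr_sumr.
(* The sums over beta of the two parities merge into one, [SIN_even] and [SIN_odd] having the same
   right-hand side. *)
rewrite [X in _ * X = _](_ : _ = \sum_(1 <= b < (2 * h + 2 - q2 - s).+1)
    (A_coef (2 * h + 1 - q2 - s) b)%:~R * E (a + b)); last first.
  rewrite [X in X + _]big_mkcond [X in _ + X]big_mkcond -big_split /=.
  apply: eq_big_nat => b /andP[b1 bq].
  have ab0 : (0 < a + b)%N by rewrite addn_gt0 a1.
  case: ifPn => ab; first by rewrite ifF ?addr0 ?SIN_even // (negPf ab).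
  by rewrite ifT ?add0r ?SIN_odd // -(negbK (odd _)).
rewrite mulr_sumr; apply: eq_big_nat => b /andP[b1 bq].
have kE : k%:R ^ (- (4 * h)%:Z - 2 + q1%:Z + q2%:Z + j%:Z + s%:Z) =
   k%:R ^- (2 * h + 1 - q1 - j) * k%:R ^- (2 * h + 1 - q2 - s) :> R.
  rewrite -invfM -exprD exprnN; congr (_ ^ _); lia.
by rewrite kE /D; ring.
Qed.

(** The sum over alpha is A_n(w) with n = 2h + 1 - q - j, so the contraction applies with s = 2h + 1
    and keeps only n = 2h. *)
Lemma Sigma2_inner_sum h m :
  G h m = (2 * h + 1)%:R * (k%:R ^- (2 * h) * (A_poly R[i] (2 * h)).[w m]).
Proof.
have s0 : (0 < 2 * h + 1)%N by rewrite addn1.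
have := bernoulli_contraction R[i] (2 * h + 1) (fun n => k%:R ^- n * (A_poly R[i]
  n).[w m]) s0.
rewrite (_ : (2 * h + 1).-1 = 2 * h)%N; last by rewrite addn1.
move=> <-; rewrite /G [in RHS]addn1; apply: eq_big_nat => q /andP[_ qh].
rewrite -[(2 * h).+1]addn1; apply: eq_big_nat => j /andP[j1 jq].
rewrite horner_A_poly !mulr_sumr.
have -> : ((2 * h + 2 - q - j).+1 = (2 * h + 1 - q - j).+2)%N by lia.
apply: eq_bigr => a _; rewrite /D.
have rE : (ratr (bernoulli q) : R)%:C = ratr (bernoulli q) := fmorph_rat
  (real_complex R) _.
have kE n : (k%:R ^- n : R)%:C = k%:R ^- n by rewrite fmorphV rmorphXn rmorph_nat.
have zE (z : int) : (z%:~R : R)%:C = z%:~R by rewrite rmorph_int.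
have nE (n : nat) : (n%:R : R)%:C = n%:R by rewrite rmorph_nat.
have MC (x y : R) : (x * y)%:C = x%:C * y%:C := rmorphM (real_complex R) x y.
by rewrite 4!MC rE kE zE !nE; ring.
Qed.

(** By [A_poly_cot_poly] with a = -i/2, A_{2h}(w) is a^(2h+1) times a real number, and the square of
    a^(2h+1) is (-1/4)^(2h+1), which is negative. *)
Lemma Sigma2_cot_deriv h : (0 < h)%N ->
  Sigma2 R k h = - ((2 * h + 1)%:R ^+ 2 * k%:R ^- (4 * h) * 4 ^- (2 * h + 1)) *
    \sum_(1 <= m < k.+1 | coprime m k) cot_deriv (2 * h) (m%:R / k%:R) ^+ 2.
Proof.
move=> h0; rewrite Sigma2_Re_sqr mulr_sumr; apply: eq_bigr => m _.
rewrite Sigma2_inner_sum.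
pose y : R := cot (pi * (m%:R / k%:R)).
pose a : R[i] := 0 -i* 2^-1.
have wE : w m = a * y%:C + (- 2^-1).
  rewrite /w /cot_root -mulrA -/y -(rmorph_nat (real_complex R) 2) -fmorphV -rmorphN.
  by apply/eqP; rewrite eq_complex /=; apply/andP; split; apply/eqP; ring.
have a2 : a ^+ 2 = - (2^-1) ^+ 2.
  rewrite -(rmorph_nat (real_complex R) 2) -fmorphV -rmorphXn -rmorphN expr2.
  by apply/eqP; rewrite eq_complex /=; apply/andP; split; apply/eqP; rewrite ?expr2; ring.
have two0 : (2%:R : R[i]) != 0 by rewrite pnatr_eq0.
have h2 : (0 < 2 * h)%N by rewrite muln_gt0.
have AE : (A_poly R[i] (2 * h)).[w m] = a ^+ (2 * h).+1 * (cot_deriv (2 * h) (m%:R /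
  k%:R) : R)%:C.
  have := congr1 (horner^~ y%:C) (A_poly_cot_poly R[i] (2 * h) a _ a2 erefl two0 h2).
  rewrite /cot_deriv -/y horner_comp !hornerE -wE => ->.
  by rewrite -(map_cot_poly _ _ (real_complex R)) horner_map.
rewrite AE; set f := cot_deriv _ _.
have a2h : a ^+ (2 * h).+1 * a ^+ (2 * h).+1 = (- 4 ^- (2 * h + 1))%:C.
  rewrite -expr2 -exprM mulnC exprM a2 -(rmorph_nat (real_complex R) 2) -fmorphV.
  rewrite -rmorphXn -rmorphN -rmorphXn; congr (_%:C).
  rewrite exprNn addn1 -signr_odd /= oddM /= expr1 mulN1r -exprVn; congr (- (_ ^+ _)).
  by rewrite expr2; field.
transitivity (complex.Re ((((2 * h + 1)%:R * k%:R ^- (2 * h)) ^+ 2 * (- 4 ^- (2 * h +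
  1)) * f ^+ 2)%:C)).
  congr complex.Re.
  have -> : forall (x b c : R[i]), x * (b * (c * f%:C)) * (x * (b * (c * f%:C))) =
      (x * b) ^+ 2 * (c * c) * f%:C ^+ 2 by move=> x b c; ring.
  have MC (u v : R) : (u * v)%:C = u%:C * v%:C := rmorphM (real_complex R) u v.
  have XC (u : R) n : (u ^+ n)%:C = u%:C ^+ n := rmorphXn (real_complex R) n u.
  have kE : (k%:R ^- (2 * h) : R)%:C = k%:R ^- (2 * h).
    by rewrite fmorphV rmorphXn rmorph_nat.
  have nE : ((2 * h + 1)%:R : R)%:C = (2 * h + 1)%:R by rewrite rmorph_nat.
  by rewrite a2h 2!MC 2!XC MC kE nE.
have -> : k%:R ^- (4 * h) = (k%:R ^- (2 * h)) ^+ 2 :> R.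
  by rewrite exprVn -exprM; congr (_ ^- _); lia.
by rewrite /=; ring.
Qed.

End SigmaTwo.

Theorem theorem3p2 (R : realType) (k h : nat) (hk : (3 <= k)%N) (hh : (1 <= h)%N) :
  \sum_(chi \in odd_dirichlet_chars R k)
     `|dirichlet_L (2 * h + 1)%:R chi| ^+ 2
  = (- (2 ^+ (4 * h) * pi ^+ (4 * h + 2)
        / ((2 * h + 1)`!%:R ^+ 2 * k%:R ^+ 2)
        * (totient k)%:R * Sigma2 R k h))%:C.
Proof.
have k1 : (1 < k)%N by exact: ltnW.
have h2 : (2 <= 2 * h)%N by rewrite leq_pmulr.
have h3 : (2 <= (2 * h).+1)%N by exact: ltnW.
have even_2h : ~~ odd (2 * h) by rewrite oddM.
have kR : (k%:R : R) != 0 by rewrite pnatr_eq0 -lt0n ltnW.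
transitivity (\sum_(chi \in odd_dirichlet_chars R k)
    `|\sum_a chi a * (residue_sum R k (2 * h).+1 a)%:C| ^+ 2).
  by apply: eq_fsbigr => chi _; rewrite addn1 (dirichlet_L_residue_sum R k _ h3).
rewrite sum_odd_dirichlet_chars; congr (_%:C).
have -> : #|{: {unit 'Z_k}}| = totient k by rewrite -card_units_Zp ?cardsT // ltnW.
pose f (m : nat) : R := cot_deriv (2 * h) (m%:R / k%:R).
(* A unit has its representative strictly between 0 and k, as [residue_sum_sub] requires. *)
rewrite (eq_bigr (fun u : {unit 'Z_k} =>
  ((pi / k%:R) ^+ (2 * h).+1 / (2 * h)`!%:R) ^+ 2 * f (nat_of_ord (val u)) ^+ 2));
    last first.
  move=> u _; rewrite -exprMn; congr (_ ^+ _).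
  have uE : (nat_of_ord (val u))%:R = val u by rewrite natr_Zp.
  have uI : (0 < val u < k)%N.
    apply/andP; split; last by apply: leq_trans (ltn_ord _) _; rewrite Zp_cast.
    by rewrite lt0n; apply: contraTneq (valP u) => u0; rewrite -uE u0 unitZpE //
      /coprime gcdn0 gtn_eqF.
  by rewrite /f -(residue_sum_sub R k _ _ k1 even_2h h2 uI) uE.
rewrite -mulr_sumr (sum_units_Zp R k (fun m => f m ^+ 2)) // Sigma2_cot_deriv //.
set T := \sum_(1 <= m < k.+1 | _) _; set phi : R := (totient k)%:R.
have f0 j : (j`!%:R : R) != 0 by rewrite pnatr_eq0 -lt0n fact_gt0.
(* Both sides are now multiples of T. The constants agree since (2h+1)! = (2h+1) (2h)! and 2^(4h) /
   4^(2h+1) = 1/4; all exponents are rewritten in 2h, which is then generalised. *)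
have -> : (4 * h = 2 * h * 2)%N by lia.
have -> : (2 * h * 2 + 2 = (2 * h + 1) * 2)%N by lia.
have -> : (4 : R) = 2 ^+ 2 by ring.
move: (2 * h)%N => q.
have s0 : ((q + 1)%:R : R) != 0 by rewrite pnatr_eq0 addn1.
have -> : ((q + 1)`!%:R : R) = (q + 1)%:R * q`!%:R by rewrite addn1 factS natrM.
rewrite -[q.+1]addn1 -exprM [(2 * (q + 1))%N]mulnC !(exprM _ _ 2) !exprD !expr1
  !expr_div_n.
have P0 (x : R) j : x != 0 -> x ^+ j != 0 by move=> ?; rewrite expf_neq0.
move: (q + 1)%:R s0 => s1 s0.
by field; rewrite kR s0 f0 ?P0 // pnatr_eq0.
Qed.
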